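(* Let $0<\alpha<\frac13$, $\beta<-\alpha$ and $c_0>0$. There exists a positive number $\varepsilon_0=\varepsilon_0(\alpha,\beta,c_0)$ such that the following holds. Let $(u,b,\pi)$ be a smooth solution of the 2D stationary MHD equations on the entire plane $\mathbb{R}^2$ such that, for all $x\in\mathbb{R}^2$, $$|u(x)|\le c_0(1+|x|)^{\alpha},\qquad |b(x)|\le c_0(1+|x|)^{\beta}.$$ If $$\|b\|_{L^{1}(\mathbb{R}^2)}+\big\||h|^{\frac13}\big\|_{L^{1}(\mathbb{R}^2)}\le \varepsilon_0,$$ then $u$ and $\pi$ are constants and $b\equiv 0$.
   Context: The 2D stationary incompressible MHD equations on $\mathbb{R}^2$, for a velocity field $u=(u_1,u_2):\mathbb{R}^2\to\mathbb{R}^2$, a magnetic field $b=(b_1,b_2):\mathbb{R}^2\to\mathbb{R}^2$ and a pressure $\pi:\mathbb{R}^2\to\mathbb{R}$, are $$-\Delta u+u\cdot\nabla u+\nabla\pi=b\cdot\nabla b,\qquad -\Delta b+u\cdot\nabla b=b\cdot\nabla u,\qquad \operatorname{div}u=0,\qquad \operatorname{div}b=0.$$ The function $h$ is defined by $h=\partial_2 b_1-\partial_1 b_2$. *)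

(* Defs.v *)
From HB Require Import structures.
From mathcomp Require Import all_boot all_order all_algebra.
From mathcomp Require Import all_classical all_reals all_analysis.

Set Implicit Arguments.
Unset Strict Implicit.
Unset Printing Implicit Defensive.

Import Order.TTheory GRing.Theory Num.Theory.
Import numFieldNormedType.Exports.

Local Open Scope classical_set_scope.
Local Open Scope ring_scope.

Section Plane.
Variable R : realType.

(* The canonical norm `|x| on R * R is the sup norm, hence this definition. *)
Definition eucl (x : R * R) : R := Num.sqrt (x.1 ^+ 2 + x.2 ^+ 2).

Definition lebesgue2 :
    {measure set (measurableTypeR R * measurableTypeR R) -> \bar R} :=
  (@lebesgue_measure R \x @lebesgue_measure R)%E.

Definition L1norm (f : R * R -> R) : \bar R :=
  Lnorm lebesgue2 1%:E (EFin \o f).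

Definition e1 : R * R := (1, 0).
Definition e2 : R * R := (0, 1).

Section Derivatives.
Variable V : normedModType R.
Implicit Types f : R * R -> V.

Definition d1 f : R * R -> V := fun x => 'D_e1 f x.
Definition d2 f : R * R -> V := fun x => 'D_e2 f x.

Fixpoint Ck (n : nat) f : Prop :=
  continuous f /\
  if n is m.+1 then
    [/\ forall x, derivable f x e1, forall x, derivable f x e2,
        Ck m (d1 f) & Ck m (d2 f)]
  else True.

Definition smooth f : Prop := forall n, Ck n f.

Definition laplacian f : R * R -> V := fun x => d1 (d1 f) x + d2 (d2 f) x.

(* (v . nabla) f *)
Definition advect (v : R * R -> R * R) f : R * R -> V :=
  fun x => (v x).1 *: d1 f x + (v x).2 *: d2 f x.

End Derivatives.

Definition grad (p : R * R -> R) : R * R -> R * R := fun x => (d1 p x, d2 p x).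

Definition div (v : R * R -> R * R) : R * R -> R :=
  fun x => d1 (fun y => (v y).1) x + d2 (fun y => (v y).2) x.

Record smooth_stationary_MHD (u b : R * R -> R * R) (p : R * R -> R) : Prop :=
  SmoothStationaryMHD {
    MHD_smooth_u : smooth u;
    MHD_smooth_b : smooth b;
    MHD_smooth_p : smooth p;
    MHD_momentum : forall x,
      - laplacian u x + advect u u x + grad p x = advect b b x;
    MHD_induction : forall x, - laplacian b x + advect u b x = advect b u x;
    MHD_div_u : forall x, div u x = 0;
    MHD_div_b : forall x, div b x = 0 }.

(* The function h; its sign is opposite to the usual scalar curl of b. *)
Definition current (b : R * R -> R * R) : R * R -> R :=
  fun x => d2 (fun y => (b y).1) x - d1 (fun y => (b y).2) x.

End Plane.

(* Main.v *)
Require Import Defs.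
From HB Require Import structures.
From mathcomp Require Import all_boot all_order all_algebra.
From mathcomp Require Import all_classical all_reals all_analysis.
From mathcomp Require Import measurable_realfun ring lra.
Import Order.TTheory GRing.Theory Num.Theory.
Import numFieldNormedType.Exports.
Local Open Scope classical_set_scope.
Local Open Scope ring_scope.

(** The magnetic field is shown to vanish, and the velocity is then handled as
a solution of the stationary Navier-Stokes equations.

Magnetic field. Since div b = 0, there is a stream function psi with
d1 psi = - b2 and d2 psi = b1 ([stream_function]), and h is its Laplacian.
The induction equation says exactly that the gradient of h + u1 b2 - u2 b1
vanishes ([ohm_const]), so Lap psi = u . grad psi + c for some constant c.
As alpha + beta < 0, the term u . grad psi decays, while grad psi = O(1); a
nonzero c would make psi grow quadratically on large remote squares, which a
bounded gradient forbids ([no_source]). So c = 0 and psi obeys the maximum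
principle. Now integrability enters: by Tonelli there are vertical and
horizontal lines, arbitrarily far away on each side of the origin, on which
the integral of |b| is as small as desired. They bound rectangles that exhaust
the plane and on whose borders psi oscillates very little; by the maximum
principle psi oscillates very little inside as well. Hence psi is constant
([integrable_gradient_flat]) and b = 0.

Velocity. The vorticity w = d2 u1 - d1 u2 satisfies Lap w = u . grad w with
div u = 0. For even n, consider the moments X_n(r), the integrals over the
square [-r, r]^2 of (w phi)^n with phi a cutoff vanishing on the border of the
square, and let A bound |u| on this square. Replacing one factor w by the curl
of u and integrating by parts leaves terms with a factor u and a gradient of w
or phi; the gradient of w is absorbed with the energy (Caccioppoli) estimate
for the equation of w. The result is X_(n+2) <= K (A^3 / r) X_n
([moment_step]). For A of order r^alpha with alpha < 1/3 the factor is a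
negative power of r, while X_0 is of order r^2: after finitely many steps X_n
tends to 0 as r grows, so w = 0 ([transport_liouville]). With w = 0 the
components of u are harmonic; a partial derivative of a harmonic function is
itself harmonic and is the curl of a field with one zero component, so the
same theorem, with zero drift, shows that it vanishes ([harmonic_const]).
Thus u is constant, the momentum equation reduces to grad pi = 0, and pi is
constant. *)

Set Implicit Arguments.
Unset Strict Implicit.
Unset Printing Implicit Defensive.

(** * Functions of two variables with explicit partial derivatives *)

Section Calculus.
Variable R : realType.
Implicit Types f g : R * R -> R.

(** The partial derivatives are arguments of the predicate, so that the rules
below compute them by unification, and an identity between functions can be
differentiated by computing the derivatives of both sides. *)
Record C1 f f1 f2 : Prop := MkC1 {
  C1_cont : continuous f;
  C1_cont1 : continuous f1;
  C1_cont2 : continuous f2;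
  C1_d1 : forall x, is_derive x (@e1 R) f (f1 x);
  C1_d2 : forall x, is_derive x (@e2 R) f (f2 x) }.

Lemma slice1E f (x y : R) :
  (fun h : R => h^-1 *: ((f \o shift (x, y)) (h *: @e1 R) - f (x, y))) =
  (fun h : R => h^-1 *: (((fun t => f (t, y)) \o shift x) (h *: (1 : R)) - f (x, y))).
Proof.
apply/funext => h /=; congr (_ *: (f _ - _)).
by change ((h *: (1 : R) + x, h *: (0 : R) + y) = (h *: (1 : R) + x, y));
  rewrite scaler0 add0r.
Qed.

Lemma slice2E f (x y : R) :
  (fun h : R => h^-1 *: ((f \o shift (x, y)) (h *: @e2 R) - f (x, y))) =
  (fun h : R => h^-1 *: (((fun t => f (x, t)) \o shift y) (h *: (1 : R)) - f (x, y))).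
Proof.
apply/funext => h /=; congr (_ *: (f _ - _)).
by change ((h *: (0 : R) + x, h *: (1 : R) + y) = (x, h *: (1 : R) + y));
  rewrite scaler0 add0r.
Qed.

Lemma is_derive_slice1 f (x y l : R) :
  is_derive (x, y) (@e1 R) f l <-> is_derive x 1 (fun t => f (t, y)) l.
Proof.
split=> -[df vf]; constructor.
- by move: df; rewrite /derivable slice1E.
- by move: vf; rewrite /derive slice1E.
- by rewrite /derivable slice1E.
- by rewrite /derive slice1E.
Qed.

Lemma is_derive_slice2 f (x y l : R) :
  is_derive (x, y) (@e2 R) f l <-> is_derive y 1 (fun t => f (x, t)) l.
Proof.
split=> -[df vf]; constructor.
- by move: df; rewrite /derivable slice2E.
- by move: vf; rewrite /derive slice2E.
- by rewrite /derivable slice2E.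
- by rewrite /derive slice2E.
Qed.

Lemma slice1_cont f y : continuous f -> continuous (fun t => f (t, y)).
Proof.
move=> cf t; apply: (@continuous_comp _ _ _ (fun t : R => (t, y)) f); last exact: cf.
exact: (@cvg_pair _ _ _ (nbhs t) (nbhs t) (nbhs y) _ _ _ id (fun=> y) cvg_id (cvg_cst y)).
Qed.

Lemma slice2_cont f x : continuous f -> continuous (fun t => f (x, t)).
Proof.
move=> cf t; apply: (@continuous_comp _ _ _ (fun t : R => (x, t)) f); last exact: cf.
exact: (@cvg_pair _ _ _ (nbhs t) (nbhs x) (nbhs t) _ _ _ (fun=> x) id (cvg_cst x) cvg_id).
Qed.

Lemma cont_fst : continuous (fun x : R * R => x.1).
Proof. by move=> x; exact: cvg_fst. Qed.
Lemma cont_snd : continuous (fun x : R * R => x.2).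
Proof. by move=> x; exact: cvg_snd. Qed.

Lemma cont_comp_fst (G : R * R -> R * R) : continuous G -> continuous (fun x => (G x).1).
Proof.
move=> cG x.
have H : {for G x, continuous (fun x : R * R => x.1)} by exact: cont_fst.
exact: (continuous_comp (cG x) H).
Qed.

Lemma cont_comp_snd (G : R * R -> R * R) : continuous G -> continuous (fun x => (G x).2).
Proof.
move=> cG x.
have H : {for G x, continuous (fun x : R * R => x.2)} by exact: cont_snd.
exact: (continuous_comp (cG x) H).
Qed.

Lemma contD f g : continuous f -> continuous g -> continuous (fun x => f x + g x).
Proof. by move=> cf cg x; apply: cvgD; [exact: cf|exact: cg]. Qed.
Lemma contN f : continuous f -> continuous (fun x => - f x).
Proof. by move=> cf x; apply: cvgN; exact: cf. Qed.
Lemma contM f g : continuous f -> continuous g -> continuous (fun x => f x * g x).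
Proof. by move=> cf cg x; apply: cvgM; [exact: cf|exact: cg]. Qed.
Lemma contX f n : continuous f -> continuous (fun x => f x ^+ n).
Proof.
move=> cf; elim: n => [|n IH]; first by move=> x; exact: cvg_cst.
have -> : (fun x => f x ^+ n.+1) = (fun x => f x * f x ^+ n).
  by apply/funext => x; rewrite exprS.
exact: contM.
Qed.

Lemma C1_cst (c : R) : C1 (fun=> c) (fun=> 0) (fun=> 0).
Proof.
by split=> x; try exact: cvg_cst; apply: is_derive_cst.
Qed.

Lemma C1_fst : C1 (fun x => x.1) (fun=> 1) (fun=> 0).
Proof.
split; [exact: cont_fst| | | |]; try by move=> x; exact: cvg_cst.
- by move=> -[x y]; apply/is_derive_slice1 => /=; exact: is_derive_id.
- by move=> -[x y]; apply/is_derive_slice2 => /=; exact: is_derive_cst.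
Qed.

Lemma C1_snd : C1 (fun x => x.2) (fun=> 0) (fun=> 1).
Proof.
split; [exact: cont_snd| | | |]; try by move=> x; exact: cvg_cst.
- by move=> -[x y]; apply/is_derive_slice1 => /=; exact: is_derive_cst.
- by move=> -[x y]; apply/is_derive_slice2 => /=; exact: is_derive_id.
Qed.

Lemma C1D f f1 f2 g g1 g2 : C1 f f1 f2 -> C1 g g1 g2 ->
  C1 (fun x => f x + g x) (fun x => f1 x + g1 x) (fun x => f2 x + g2 x).
Proof.
move=> [? ? ? d1f d2f] [? ? ? d1g d2g]; split; try exact: contD.
- by move=> x; exact: (is_deriveD (d1f x) (d1g x)).
- by move=> x; exact: (is_deriveD (d2f x) (d2g x)).
Qed.

Lemma C1N f f1 f2 : C1 f f1 f2 ->
  C1 (fun x => - f x) (fun x => - f1 x) (fun x => - f2 x).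
Proof.
move=> [? ? ? d1f d2f]; split; try exact: contN.
- by move=> x; exact: (is_deriveN (d1f x)).
- by move=> x; exact: (is_deriveN (d2f x)).
Qed.

Lemma C1M f f1 f2 g g1 g2 : C1 f f1 f2 -> C1 g g1 g2 ->
  C1 (fun x => f x * g x) (fun x => f1 x * g x + f x * g1 x)
     (fun x => f2 x * g x + f x * g2 x).
Proof.
move=> [? ? ? d1f d2f] [? ? ? d1g d2g].
split; try by try apply: contD; apply: contM.
- move=> x; have := is_deriveM (d1f x) (d1g x).
  by rewrite addrC /GRing.scale /= (mulrC (g x)).
- move=> x; have := is_deriveM (d2f x) (d2g x).
  by rewrite addrC /GRing.scale /= (mulrC (g x)).
Qed.

Lemma C1_eq f f1 f2 g g1 g2 : C1 f f1 f2 -> f =1 g -> f1 =1 g1 -> f2 =1 g2 ->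
  C1 g g1 g2.
Proof. by move=> ? /funext <- /funext <- /funext <-. Qed.

Lemma C1X f f1 f2 n : C1 f f1 f2 ->
  C1 (fun x => f x ^+ n) (fun x => n%:R * f x ^+ n.-1 * f1 x)
     (fun x => n%:R * f x ^+ n.-1 * f2 x).
Proof.
move=> Cf; elim: n => [|n IH].
  by apply: (C1_eq (C1_cst 1)) => x; rewrite ?expr0 ?mul0r.
apply: (C1_eq (C1M Cf IH)) => x /=; first by rewrite exprS.
  by case: n {IH} => [|n] /=; rewrite ?expr0 ?exprS -?natr1; ring.
by case: n {IH} => [|n] /=; rewrite ?expr0 ?exprS -?natr1; ring.
Qed.

Lemma C1_uniq1 f f1 f2 g1 g2 : C1 f f1 f2 -> C1 f g1 g2 -> f1 =1 g1.
Proof.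
move=> [_ _ _ + _] [_ _ _ + _] x => /(_ x)[_ <-] /(_ x)[_ <-] //.
Qed.
Lemma C1_uniq2 f f1 f2 g1 g2 : C1 f f1 f2 -> C1 f g1 g2 -> f2 =1 g2.
Proof.
move=> [_ _ _ _ +] [_ _ _ _ +] x => /(_ x)[_ <-] /(_ x)[_ <-] //.
Qed.

Lemma smooth_C1 f : smooth f -> C1 f (d1 f) (d2 f).
Proof.
move=> /(_ 1%N) /= [cf [df1 df2 [c1 _] [c2 _]]].
split; [exact: cf|exact: c1|exact: c2| |] => x; apply: derivableP.
  exact: df1.
exact: df2.
Qed.

Lemma smooth_d1 (V : normedModType R) (f : R * R -> V) : smooth f -> smooth (d1 f).
Proof. by move=> sf n; have /= [_ []] := sf n.+1. Qed.
Lemma smooth_d2 (V : normedModType R) (f : R * R -> V) : smooth f -> smooth (d2 f).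
Proof. by move=> sf n; have /= [_ []] := sf n.+1. Qed.

Lemma is_derive_fst (F : R * R -> R * R) x v : derivable F x v ->
  is_derive x v (fun y => (F y).1) ('D_v F x).1.
Proof.
move=> dF.
have H : (fun h : R => h^-1 *: (((fun y => (F y).1) \o shift x) (h *: v) - (F x).1))
    @ (0 : R)^' --> ('D_v F x).1.
  have dF' : (fun h : R => h^-1 *: ((F \o shift x) (h *: v) - F x))
    @ (0 : R)^' --> 'D_v F x by exact: dF.
  by apply: (cvg_comp _ (fun z : R * R => z.1) dF'); exact: cont_fst.
constructor; first by apply: cvgP H.
exact: cvg_lim H.
Qed.

Lemma is_derive_snd (F : R * R -> R * R) x v : derivable F x v ->
  is_derive x v (fun y => (F y).2) ('D_v F x).2.
Proof.
move=> dF.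
have H : (fun h : R => h^-1 *: (((fun y => (F y).2) \o shift x) (h *: v) - (F x).2))
    @ (0 : R)^' --> ('D_v F x).2.
  have dF' : (fun h : R => h^-1 *: ((F \o shift x) (h *: v) - F x))
    @ (0 : R)^' --> 'D_v F x by exact: dF.
  by apply: (cvg_comp _ (fun z : R * R => z.2) dF'); exact: cont_snd.
constructor; first by apply: cvgP H.
exact: cvg_lim H.
Qed.

Lemma smooth_fst (F : R * R -> R * R) : smooth F ->
  smooth (fun x => (F x).1) /\
  (forall x, d1 (fun x => (F x).1) x = (d1 F x).1) /\
  (forall x, d2 (fun x => (F x).1) x = (d2 F x).1).
Proof.
have E1 (G : R * R -> R * R) x v : derivable G x v -> 'D_v (fun y => (G y).1) x
  = ('D_v G x).1.
  by move=> dG; have [] := is_derive_fst dG.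
have key n : forall G : R * R -> R * R, Ck n G -> Ck n (fun x => (G x).1).
  elim: n => [|n IH] G /= [cG HG].
    by split=> //; exact: cont_comp_fst.
  split; first exact: cont_comp_fst.
  case: HG => dG1 dG2 c1 c2; split.
  - by move=> x; have [] := is_derive_fst (dG1 x).
  - by move=> x; have [] := is_derive_fst (dG2 x).
  - have -> : d1 (fun x => (G x).1) = (fun x => (d1 G x).1).
      by apply/funext => x; exact: E1.
    exact: IH.
  - have -> : d2 (fun x => (G x).1) = (fun x => (d2 G x).1).
      by apply/funext => x; exact: E1.
    exact: IH.
move=> sF; split; first by move=> n; exact: key.
by have /= [_ [dF1 dF2 _ _]] := sF 1%N; split=> x; exact: E1.
Qed.

Lemma smooth_snd (F : R * R -> R * R) : smooth F ->
  smooth (fun x => (F x).2) /\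
  (forall x, d1 (fun x => (F x).2) x = (d1 F x).2) /\
  (forall x, d2 (fun x => (F x).2) x = (d2 F x).2).
Proof.
have E1 (G : R * R -> R * R) x v : derivable G x v -> 'D_v (fun y => (G y).2) x
  = ('D_v G x).2.
  by move=> dG; have [] := is_derive_snd dG.
have key n : forall G : R * R -> R * R, Ck n G -> Ck n (fun x => (G x).2).
  elim: n => [|n IH] G /= [cG HG].
    by split=> //; exact: cont_comp_snd.
  split; first exact: cont_comp_snd.
  case: HG => dG1 dG2 c1 c2; split.
  - by move=> x; have [] := is_derive_snd (dG1 x).
  - by move=> x; have [] := is_derive_snd (dG2 x).
  - have -> : d1 (fun x => (G x).2) = (fun x => (d1 G x).2).
      by apply/funext => x; exact: E1.
    exact: IH.
  - have -> : d2 (fun x => (G x).2) = (fun x => (d2 G x).2).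
      by apply/funext => x; exact: E1.
    exact: IH.
move=> sF; split; first by move=> n; exact: key.
by have /= [_ [dF1 dF2 _ _]] := sF 1%N; split=> x; exact: E1.
Qed.

End Calculus.

(** * Integration over a segment and over a square *)

Section Integration.
Variable R : realType.
Notation mu := (@lebesgue_measure R).
Implicit Types (a b : R) (f g : R * R -> R).

(** Meant for a <= b: it is 0, not the opposite integral, when b < a. *)
Definition segint a b (f : R -> R) : R := \int[mu]_(t in `[a, b]) f t.

Lemma cont_integrable a b (f : R -> R) : continuous f ->
  mu.-integrable `[a, b] (EFin \o f).
Proof.
move=> cf; apply: continuous_compact_integrable; first exact: segment_compact.
exact: continuous_subspaceT.
Qed.

Lemma segintD a b (f g : R -> R) : continuous f -> continuous g ->
  segint a b (fun t => f t + g t) = segint a b f + segint a b g.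
Proof. by move=> cf cg; apply: RintegralD => //; exact: cont_integrable. Qed.

Lemma segintZ a b k (f : R -> R) : continuous f ->
  segint a b (fun t => k * f t) = k * segint a b f.
Proof. by move=> cf; apply: RintegralZl => //; exact: cont_integrable. Qed.

Lemma segint_le a b (f g : R -> R) : continuous f -> continuous g ->
  (forall t, a <= t <= b -> f t <= g t) -> segint a b f <= segint a b g.
Proof.
by move=> cf cg fg; apply: le_Rintegral => //; exact: cont_integrable.
Qed.

Lemma segint_ge0 a b (f : R -> R) :
  (forall t, a <= t <= b -> 0 <= f t) -> 0 <= segint a b f.
Proof. by move=> f0; apply: Rintegral_ge0 => t /=; rewrite in_itv /= => /f0. Qed.

Lemma segint_cst a b (k : R) : a <= b -> segint a b (fun=> k) = k * (b - a).
Proof.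
move=> ab; rewrite /segint Rintegral_cst//= lebesgue_measure_itv /=.
rewrite lte_fin; move: ab; rewrite le_eqVlt => /predU1P[->|ab].
  by rewrite ltxx subrr.
by rewrite ab.
Qed.

Lemma segint_FTC a b (F f : R -> R) : a < b -> continuous f ->
  (forall x, is_derive x (1 : R) F (f x)) -> segint a b f = F b - F a.
Proof.
move=> ab cf dF.
have cF : continuous F.
  move=> x; apply: differentiable_continuous; apply/derivable1_diffP.
  by have [] := dF x.
rewrite /segint /Rintegral (@continuous_FTC2 _ f F)//.
- exact: continuous_subspaceT.
- split; first by move=> x _; have [] := dF x.
  + by apply: cvg_at_right_filter; exact: cF.
  + by apply: cvg_at_left_filter; exact: cF.
- by move=> x _; rewrite derive1E; have [] := dF x.
Qed.

Lemma box_bounded f (a b c d : R) : continuous f -> a <= b -> c <= d ->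
  exists M, forall x y, a <= x <= b -> c <= y <= d -> `|f (x, y)| <= M.
Proof.
move=> cf ab cd.
have [] := @compact_EVT_max _ R (fun z => `|f z|) (`[a, b] `*` `[c, d]).
- by exists (a, c); split; rewrite /= in_itv /= lexx.
- by apply: compact_setX; exact: segment_compact.
- apply: continuous_subspaceT => z.
  by apply: (continuous_comp (cf z)); exact: norm_continuous.
move=> z _ Hz; exists `|f z| => x y xab ycd; apply: Hz; rewrite inE /=.
by split; rewrite /= in_itv.
Qed.

(** Dominated convergence: f is bounded on a compact rectangle around the
segment. *)
Lemma segint_param_cont f a b : continuous f -> a <= b ->
  continuous (fun x => segint a b (fun y => f (x, y))).
Proof.
move=> cf ab x0.
have [||M HM] := @box_bounded f (x0 - 1) (x0 + 1) a b cf; try lra.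
have := @continuity_under_integral R _ _ mu (fun x y => f (x, y)) `[a, b]
  _ (x0 - 1) (x0 + 1) _ _ (fun=> M).
apply => //.
- by move=> x _; apply: cont_integrable; exact: slice2_cont.
- by apply: aeW => y _ x _; exact: slice1_cont.
- by apply: cont_integrable => ?; exact: cvg_cst.
- move=> x; rewrite /= in_itv /= => /andP[x1 x2]; apply: aeW => y /=.
  by rewrite in_itv /= => yab; apply: HM => //; rewrite !ltW.
- by rewrite inE /= in_itv /=; lra.
Qed.

Lemma segint_param_derive f f1 a b x : continuous f -> continuous f1 ->
  (forall z, is_derive z (@e1 R) f (f1 z)) -> a <= b ->
  is_derive x (1 : R) (fun x => segint a b (fun y => f (x, y)))
    (segint a b (fun y => f1 (x, y))).
Proof.
move=> cf cf1 df ab.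
have [||M HM] := @box_bounded f1 (x - 1) (x + 1) a b cf1; try lra.
have E t y : partial1of2 (fun x y => f (x, y)) t y = f1 (t, y).
  rewrite partial1of2E.
  by have /is_derive_slice1[_ ->] := df (t, y).
have Ix : `]x - 1, x + 1[%classic x by rewrite /= in_itv /=; lra.
have M0 : 0 <= M.
  apply: le_trans (HM x a _ _); rewrite ?normr_ge0 ?lexx//.
  by lra.
have H1 : forall t, `]x - 1, x + 1[%classic t ->
    mu.-integrable `[a, b] (EFin \o (fun y => f (t, y))).
  by move=> t _; apply: cont_integrable; exact: slice2_cont.
have H2 : forall t y, `]x - 1, x + 1[%classic t -> `[a, b]%classic y ->
    derivable ((fun x y => f (x, y)) ^~ y) t 1.
  by move=> t y _ _; have /is_derive_slice1[] := df (t, y).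
have H3 : mu.-integrable `[a, b] (EFin \o fun=> M).
  by apply: cont_integrable => ?; exact: cvg_cst.
have H4 : forall t y, `]x - 1, x + 1[%classic t -> `[a, b]%classic y ->
    `|partial1of2 (fun x y => f (x, y)) t y| <= M.
  move=> t y; rewrite /= !in_itv /= => /andP[x1 x2] yab; rewrite E.
  by apply: HM => //; rewrite !ltW.
split.
  exact: (@derivable_under_integral R _ _ mu (fun x y => f (x, y)) `[a, b]
    _ x (x - 1) (x + 1) Ix H1 H2 (fun=> M) (fun=> M0) H3 H4).
rewrite -derive1E.
rewrite (@differentiation_under_integral R _ _ mu (fun x y => f (x, y)) `[a, b]
    _ x (x - 1) (x + 1) Ix H1 H2 (fun=> M) (fun=> M0) H3 H4)//.
by congr (segint a b _); apply/funext => y; exact: E.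
Qed.

Definition boxint r f : R :=
  segint (- r) r (fun x => segint (- r) r (fun y => f (x, y))).

Lemma boxintD r f g : 0 < r -> continuous f -> continuous g ->
  boxint r (fun z => f z + g z) = boxint r f + boxint r g.
Proof.
move=> r0 cf cg; rewrite /boxint -segintD; last 2 first.
- by apply: segint_param_cont => //; lra.
- by apply: segint_param_cont => //; lra.
congr (segint _ _ _); apply/funext => x.
by rewrite segintD//; exact: slice2_cont.
Qed.

Lemma boxintZ r k f : 0 < r -> continuous f ->
  boxint r (fun z => k * f z) = k * boxint r f.
Proof.
move=> r0 cf; rewrite /boxint -segintZ; last first.
  by apply: segint_param_cont => //; lra.
congr (segint _ _ _); apply/funext => x.
by rewrite segintZ//; exact: slice2_cont.
Qed.

Lemma boxint_le r f g : 0 < r -> continuous f -> continuous g ->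
  (forall x y, `|x| <= r -> `|y| <= r -> f (x, y) <= g (x, y)) ->
  boxint r f <= boxint r g.
Proof.
move=> r0 cf cg fg; apply: segint_le.
- by apply: segint_param_cont => //; lra.
- by apply: segint_param_cont => //; lra.
move=> x xr; apply: segint_le; try exact: slice2_cont.
by move=> y yr; apply: fg; rewrite ler_norml.
Qed.

Lemma boxint_cst r (k : R) : 0 < r -> boxint r (fun=> k) = k * (r * 2) ^+ 2.
Proof. by move=> r0; rewrite /boxint !segint_cst; [ring|lra..]. Qed.

Lemma segint_eq0 r (f : R -> R) : 0 < r -> continuous f ->
  (forall t, `|t| <= r -> f t = 0) -> segint (- r) r f = 0.
Proof.
move=> r0 cf f0; apply/eqP; rewrite eq_le; apply/andP; split; last first.
  by apply: segint_ge0 => t tr; rewrite f0// ler_norml.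
rewrite -[leRHS](_ : segint (- r) r (fun=> 0) = _); last first.
  by rewrite segint_cst ?mul0r//; lra.
apply: segint_le => //; first by move=> t; exact: cvg_cst.
by move=> t tr; rewrite f0// ler_norml.
Qed.

(** The two partial derivatives are treated differently because the integral
is iterated. Here the inner integral already vanishes by the fundamental
theorem of calculus. *)
Lemma boxint_d2 r F F1 F2 : 0 < r -> C1 F F1 F2 ->
  (forall x y, `|x| <= r -> `|y| = r -> F (x, y) = 0) ->
  boxint r F2 = 0.
Proof.
move=> r0 [cF cF1 cF2 dF1 dF2] F0.
have -> : boxint r F2 = segint (- r) r (fun x => F (x, r) - F (x, - r)).
  congr (segint _ _ _); apply/funext => x.
  apply: (@segint_FTC _ _ (fun y => F (x, y))); [lra|exact: slice2_cont|].
  by move=> y; apply/is_derive_slice2.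
apply: segint_eq0 => //.
  by move=> t; exact: (cvgB (@slice1_cont _ F r cF t) (@slice1_cont _ F (- r) cF t)).
move=> t tr; rewrite (F0 t r tr) ?gtr0_norm// (F0 t (- r) tr) ?subrr//.
by rewrite normrN gtr0_norm.
Qed.

(** Differentiation under the inner integral sign turns the outer integrand
into a derivative with respect to x, so that both identities are obtained from
the same iterated integral. *)
Lemma boxint_d1 r F F1 F2 : 0 < r -> C1 F F1 F2 ->
  (forall x y, `|x| = r -> `|y| <= r -> F (x, y) = 0) ->
  boxint r F1 = 0.
Proof.
move=> r0 [cF cF1 cF2 dF1 dF2] F0.
have rr : - r < r by lra.
have dF (x : R) : is_derive x (1 : R) (fun x => segint (- r) r (fun y => F (x, y)))
    (segint (- r) r (fun y => F1 (x, y))).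
  by apply: segint_param_derive => //; exact: ltW.
rewrite /boxint (segint_FTC rr (segint_param_cont cF1 (ltW rr)) dF).
rewrite !segint_eq0 ?subrr//; try exact: slice2_cont.
- by move=> t tr; rewrite F0// normrN gtr0_norm.
- by move=> t tr; rewrite F0// gtr0_norm.
Qed.

End Integration.

(** * Local estimates for a transported vorticity *)

Lemma normsq (R : realType) (x : R) : `|x| ^+ 2 = x ^+ 2.
Proof. by rewrite real_normK ?num_real. Qed.

Section Cutoff.
Variable R : realType.
Variable r : R.
Hypothesis r1 : 1 <= r.

(** As all integrals are over [-r, r]^2, a polynomial which vanishes on the
border serves as a cutoff. *)
Definition cutoff (z : R * R) : R := (1 - (z.1 / r) ^+ 2) * (1 - (z.2 / r) ^+ 2).
Definition cutoff1 (z : R * R) : R := - (2 * z.1 / r ^+ 2) * (1 - (z.2 / r) ^+ 2).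
Definition cutoff2 (z : R * R) : R := - (2 * z.2 / r ^+ 2) * (1 - (z.1 / r) ^+ 2).

Let r0 : 0 < r. Proof. exact: lt_le_trans r1. Qed.

Lemma C1_cutoff : C1 cutoff cutoff1 cutoff2.
Proof.
have C1q : C1 (fun z : R * R => 1 + - (z.1 * r^-1) ^+ 2) _ _ :=
  C1D (C1_cst 1) (C1N (C1X 2 (C1M (C1_fst R) (C1_cst r^-1)))).
have C2q : C1 (fun z : R * R => 1 + - (z.2 * r^-1) ^+ 2) _ _ :=
  C1D (C1_cst 1) (C1N (C1X 2 (C1M (C1_snd R) (C1_cst r^-1)))).
apply: (C1_eq (C1M C1q C2q)) => -[x y] //=; rewrite /cutoff1 /cutoff2 /=.
  by field; rewrite gt_eqF.
by field; rewrite gt_eqF.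
Qed.

Lemma ratio_sqr_bounds (x : R) : `|x| <= r -> 0 <= 1 - (x / r) ^+ 2 <= 1.
Proof.
move=> xr; have : (x / r) ^+ 2 <= 1.
  rewrite -normsq expr_le1// normrM normfV (gtr0_norm r0) ler_pdivrMr//.
  by rewrite mul1r.
by have := sqr_ge0 (x / r); lra.
Qed.

Lemma cutoff_bounds (x y : R) : `|x| <= r -> `|y| <= r ->
  [/\ 0 <= cutoff (x, y) <= 1, `|cutoff1 (x, y)| <= 2 / r &
      `|cutoff2 (x, y)| <= 2 / r].
Proof.
have lin t : `|t| <= r -> `|2 * t / r ^+ 2| <= 2 / r.
  move=> tr; rewrite normrM normrM normfV (@ger0_norm _ 2)// normrX (gtr0_norm r0).
  rewrite -mulrA ler_pM2l// ler_pdivrMr ?exprn_gt0// expr2 mulrA mulVf ?mul1r//.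
  by rewrite gt_eqF.
have pr s t : `|s| <= r -> `|t| <= r ->
    `| - (2 * s / r ^+ 2) * (1 - (t / r) ^+ 2)| <= 2 / r.
  move=> /lin ls /ratio_sqr_bounds /andP[t0 t1].
  rewrite normrM normrN (ger0_norm t0) -[leRHS]mulr1.
  exact: ler_pM.
move=> xr yr; split; rewrite /cutoff /cutoff1 /cutoff2 /=; [|exact: pr|exact: pr].
have /andP[x0 x1] := ratio_sqr_bounds xr.
have /andP[y0 y1] := ratio_sqr_bounds yr.
by rewrite mulr_ge0//= -[leRHS]mulr1 ler_pM.
Qed.

Lemma ratio_bdry (x : R) : `|x| = r -> 1 - (x / r) ^+ 2 = 0.
Proof.
move=> xr; rewrite -normsq normrM normfV xr (gtr0_norm r0) divff ?gt_eqF//.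
by rewrite expr1n subrr.
Qed.

Lemma cutoff_bdry1 (x y : R) : `|x| = r -> cutoff (x, y) = 0.
Proof. by move=> /ratio_bdry; rewrite /cutoff /= => ->; rewrite mul0r. Qed.
Lemma cutoff_bdry2 (x y : R) : `|y| = r -> cutoff (x, y) = 0.
Proof. by move=> /ratio_bdry; rewrite /cutoff /= => ->; rewrite mulr0. Qed.

Lemma cutoff_half (x y : R) : 2 * `|x| <= r -> 2 * `|y| <= r ->
  2^-1 <= cutoff (x, y).
Proof.
have key t : 2 * `|t| <= r -> 3 / 4 <= 1 - (t / r) ^+ 2.
  move=> tr; have : (t / r) ^+ 2 <= (2^-1) ^+ 2.
    rewrite -normsq; apply: lerXn2r; rewrite ?nnegrE// normrM normfV (gtr0_norm r0).
    by rewrite ler_pdivrMr//; lra.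
  by lra.
move=> /key xk /key yk; rewrite /cutoff /=; apply: (@le_trans _ _ (3 / 4 * (3 / 4))).
  by lra.
by apply: ler_pM => //; lra.
Qed.

(** The divergence theorem without border term, for a field (F, G). *)
Lemma boxint_div (F F1 F2 G G1 G2 : R * R -> R) (S : R * R -> R) :
  C1 F F1 F2 -> C1 G G1 G2 ->
  (forall z, cutoff z = 0 -> F z = 0) -> (forall z, cutoff z = 0 -> G z = 0) ->
  (forall z, S z = F1 z + G2 z) ->
  boxint r S = 0.
Proof.
move=> CF CG F0 G0 /funext ->.
have [_ cF1 _ _ _] := CF; have [_ _ cG2 _ _] := CG.
rewrite boxintD// (boxint_d1 r0 CF) ?(boxint_d2 r0 CG) ?addr0//.
- by move=> x y _ yr; apply: G0; exact: cutoff_bdry2.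
- by move=> x y xr _; apply: F0; exact: cutoff_bdry1.
Qed.

End Cutoff.

Lemma cont_cst (R : realType) (k : R) : continuous (fun _ : R * R => k).
Proof. by move=> z; exact: cvg_cst. Qed.

(** Continuity of polynomial expressions. The goal is matched syntactically:
unification alone would unfold the powers into products. *)
Ltac cont := match goal with
  | |- continuous (fun x => @?f x + @?g x) => apply: (@contD _ f g); cont
  | |- continuous (fun x => - @?f x) => apply: (@contN _ f); cont
  | |- continuous (fun x => @?f x ^+ ?n) => apply: (@contX _ f n); cont
  | |- continuous (fun x => @?f x * @?g x) => apply: (@contM _ f g); cont
  | |- continuous (fun x => ?c) => exact: (@cont_cst _ c)
  | _ => assumption
  end.

Lemma young_ge (R : realType) (a b t : R) : 0 < t ->
  - (t * a ^+ 2 + b ^+ 2 / (4 * t)) <= a * b.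
Proof.
move=> t0; rewrite -subr_ge0.
have -> : a * b - - (t * a ^+ 2 + b ^+ 2 / (4 * t)) = (2 * t * a + b) ^+ 2 / (4 * t).
  by field; rewrite gt_eqF.
by rewrite divr_ge0 ?sqr_ge0//; lra.
Qed.

Lemma sqr_le_norm (R : realType) (a b : R) : `|a| <= b -> a ^+ 2 <= b ^+ 2.
Proof.
by move=> ab; rewrite -normsq; apply: lerXn2r; rewrite ?nnegrE// (le_trans _ ab).
Qed.

(** Standing assumptions of the estimates: w is the curl of (v1, v2) and is
transported and diffused by the divergence-free drift (a1, a2), and both fields
are bounded by A on the square [-r, r]^2. *)
Section Step.
Variable R : realType.
Variables (r A : R) (n : nat).
Hypothesis r1 : 1 <= r.
Hypothesis A1 : 1 <= A.
Hypothesis n_even : ~~ odd n.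
Variables w w1 w2 w11 w12 w21 w22 : R * R -> R.
Variables a1 a11 a12 a2 a21 a22 v1 v11 v12 v2 v21 v22 : R * R -> R.
Hypotheses (Cw : C1 w w1 w2) (Cw1 : C1 w1 w11 w12) (Cw2 : C1 w2 w21 w22).
Hypotheses (Ca1 : C1 a1 a11 a12) (Ca2 : C1 a2 a21 a22).
Hypotheses (Cv1 : C1 v1 v11 v12) (Cv2 : C1 v2 v21 v22).
Hypothesis transport : forall z, w11 z + w22 z = a1 z * w1 z + a2 z * w2 z.
Hypothesis div_free : forall z, a11 z + a22 z = 0.
Hypothesis w_curl : forall z, w z = v12 z - v21 z.
Hypothesis bnd : forall x y, `|x| <= r -> `|y| <= r ->
  [/\ `|a1 (x, y)| <= A, `|a2 (x, y)| <= A, `|v1 (x, y)| <= A & `|v2 (x, y)| <= A].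

Let r0 : 0 < r. Proof. exact: lt_le_trans r1. Qed.
Let A0 : 0 < A. Proof. exact: lt_le_trans A1. Qed.
Let phi := cutoff r.
Let phi1 := cutoff1 r.
Let phi2 := cutoff2 r.
Let Cphi : C1 phi phi1 phi2. Proof. exact: C1_cutoff. Qed.

Definition moment (m : nat) : R := boxint r (fun z => (w z * cutoff r z) ^+ m).
Let G : R := boxint r
  (fun z => (w z * phi z) ^+ n * ((phi z ^+ 2 * w1 z) ^+ 2 + (phi z ^+ 2 * w2 z) ^+ 2)).
Let B : R := 16 * ((n%:R + 4) ^+ 2 + 1).

Let cw : continuous w. Proof. by case: Cw. Qed.
Let cw1 : continuous w1. Proof. by case: Cw1. Qed.
Let cw2 : continuous w2. Proof. by case: Cw2. Qed.
Let ca1 : continuous a1. Proof. by case: Ca1. Qed.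
Let ca2 : continuous a2. Proof. by case: Ca2. Qed.
Let cv1 : continuous v1. Proof. by case: Cv1. Qed.
Let cv2 : continuous v2. Proof. by case: Cv2. Qed.
Let cphi : continuous phi. Proof. by case: Cphi. Qed.
Let cphi1 : continuous phi1. Proof. by case: Cphi. Qed.
Let cphi2 : continuous phi2. Proof. by case: Cphi. Qed.

Let inv_r2 : r ^- 2 <= A / r.
Proof.
rewrite expr2 invfM ler_pM2r ?invr_gt0//.
by apply: le_trans A1; rewrite invf_le1.
Qed.

(** Energy estimate: the equation of w is tested against
w^(n+1) phi^(n+4). The drift is divergence free, so it contributes only through
its product with grad phi. The power n + 4 leaves phi^(n+2) next to w^(n+2)
once two factors phi have been spent on grad phi. *)
Lemma caccioppoli : G <= B * (A / r) * moment n.+2.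
Proof.
(* The sum over i of d_i (w^(n+1) w_i phi^(n+4)
   - a_i w^(n+2) phi^(n+4) / (n + 2)), simplified with the equation of w. *)
pose S z := (w z * phi z) ^+ n *
  ((n%:R + 1) * ((phi z ^+ 2 * w1 z) ^+ 2 + (phi z ^+ 2 * w2 z) ^+ 2)
  + (n%:R + 4) * w z * phi z ^+ 3 * (w1 z * phi1 z + w2 z * phi2 z)
  - (n%:R + 4) / (n%:R + 2) * (w z ^+ 2 * phi z ^+ 3 * (a1 z * phi1 z + a2 z * phi2 z))).
have n2 : (n%:R + 2 : R) != 0 by rewrite gt_eqF// ltr_wpDl.
have S0 : boxint r S = 0.
  have CF := C1D (C1M (C1M (C1X n.+1 Cw) Cw1) (C1X n.+4 Cphi))
     (C1M (C1_cst (- (n%:R + 2)^-1)) (C1M (C1M Ca1 (C1X n.+2 Cw)) (C1X n.+4 Cphi))).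
  have CG := C1D (C1M (C1M (C1X n.+1 Cw) Cw2) (C1X n.+4 Cphi))
     (C1M (C1_cst (- (n%:R + 2)^-1)) (C1M (C1M Ca2 (C1X n.+2 Cw)) (C1X n.+4 Cphi))).
  apply: (boxint_div r1 CF CG).
  - by move=> z; rewrite -/phi -/(phi z) => -> /=; rewrite expr0n /=; ring.
  - by move=> z; rewrite -/phi -/(phi z) => -> /=; rewrite expr0n /=; ring.
  move=> z /=; rewrite /S !exprS exprMn -!natr1.
  have -> : w22 z = a1 z * w1 z + a2 z * w2 z - w11 z by rewrite -transport; ring.
  have -> : a22 z = - a11 z by apply/eqP; rewrite -addr_eq0 addrC div_free.
  by field.
pose L z := 2^-1 * ((w z * phi z) ^+ n * ((phi z ^+ 2 * w1 z) ^+ 2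
  + (phi z ^+ 2 * w2 z) ^+ 2))
   + - (B / 2 * (A / r)) * (w z * phi z) ^+ n.+2.
have L0 : boxint r L <= 0.
  rewrite -S0; apply: boxint_le => //; rewrite /L /S; [cont|cont|].
  move=> x y xr yr; set z := (x, y).
  have [/andP[p0 p1] q1 q2] := cutoff_bounds r1 xr yr.
  have [b1 b2 _ _] := bnd xr yr.
  rewrite -/phi -/phi1 -/phi2 -/z in p0 p1 q1 q2 b1 b2.
  rewrite [(_ * _) ^+ n.+2](_ : _ = (w z * phi z) ^+ n * (w z * phi z) ^+ 2); last first.
    by rewrite -exprD addn2.
  rewrite !(mulrCA _ ((w z * phi z) ^+ n)) -mulrDr ler_wpM2l//.
    by rewrite exprn_even_ge0.
  have s1 : phi1 z ^+ 2 <= 4 * (A / r).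
    apply: le_trans (sqr_le_norm q1) _; rewrite exprMn exprVn.
    by rewrite (_ : 2 ^+ 2 = 4 :> R) ?ler_pM2l//; ring.
  have s2 : phi2 z ^+ 2 <= 4 * (A / r).
    apply: le_trans (sqr_le_norm q2) _; rewrite exprMn exprVn.
    by rewrite (_ : 2 ^+ 2 = 4 :> R) ?ler_pM2l//; ring.
  have s3 : a1 z * phi1 z + a2 z * phi2 z <= 4 * (A / r).
    have m1 : `|a1 z * phi1 z| <= A * (2 / r) by rewrite normrM ler_pM.
    have m2 : `|a2 z * phi2 z| <= A * (2 / r) by rewrite normrM ler_pM.
    have := ler_norm (a1 z * phi1 z); have := ler_norm (a2 z * phi2 z); lra.
  have N0 : (0 : R) <= n%:R by [].
  move: s1 s2 s3 p0 p1; rewrite /B.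
  move: (phi z) (phi1 z) (phi2 z) (a1 z * phi1 z + a2 z * phi2 z) (w z) (w1 z)
    (w2 z) => p p1 p2 s W W1 W2 s1 s2 s3 p0 p_le1.
  have y1 := @young_ge _ (p ^+ 2 * W1) ((n%:R + 4) * (W * p) * p1) 4^-1 _.
  have y2 := @young_ge _ (p ^+ 2 * W2) ((n%:R + 4) * (W * p) * p2) 4^-1 _.
  have {}y1 := y1 ltac:(lra); have {}y2 := y2 ltac:(lra).
  have Ar0 : 0 <= A / r by rewrite divr_ge0// ltW.
  have W0 : 0 <= (W * p) ^+ 2 by exact: sqr_ge0.
  have t1 : ((n%:R + 4) * (W * p) * p1) ^+ 2
    <= (n%:R + 4) ^+ 2 * (W * p) ^+ 2 * (4 * (A / r)).
    by rewrite exprMn exprMn ler_wpM2l// mulr_ge0// sqr_ge0.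
  have t2 : ((n%:R + 4) * (W * p) * p2) ^+ 2
    <= (n%:R + 4) ^+ 2 * (W * p) ^+ 2 * (4 * (A / r)).
    by rewrite exprMn exprMn ler_wpM2l// mulr_ge0// sqr_ge0.
  have ps : p * s <= 4 * (A / r).
    have h1 : p * s <= p * (4 * (A / r)) by rewrite ler_wpM2l.
    apply: le_trans h1 _; rewrite ler_piMl//; lra.
  have t3 : (n%:R + 4) / (n%:R + 2) * ((W * p) ^+ 2 * (p * s)) <=
            2 * ((W * p) ^+ 2 * (4 * (A / r))).
    apply: (@le_trans _ _ ((n%:R + 4) / (n%:R + 2) * ((W * p) ^+ 2 * (4 * (A / r))))).
      by rewrite ler_wpM2l ?ler_wpM2l// divr_ge0//; lra.
    rewrite ler_wpM2r//; first by rewrite mulr_ge0//; lra.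
    by rewrite ler_pdivrMr; lra.
  rewrite (_ : (n%:R + 4) * W * p ^+ 3 * (W1 * p1 + W2 * p2) =
    p ^+ 2 * W1 * ((n%:R + 4) * (W * p) * p1) + p ^+ 2 * W2 * ((n%:R + 4) * (W * p) * p2));
    last by ring.
  rewrite (_ : W ^+ 2 * p ^+ 3 * s = (W * p) ^+ 2 * (p * s)); last by ring.
  have g1 := sqr_ge0 (p ^+ 2 * W1); have g2 := sqr_ge0 (p ^+ 2 * W2).
  have e1 : 0 <= n%:R * ((p ^+ 2 * W1) ^+ 2 + (p ^+ 2 * W2) ^+ 2).
    by rewrite mulr_ge0// addr_ge0.
  have four : 4 * 4^-1 = 1 :> R by rewrite divff.
  rewrite four !divr1 in y1 y2.
  by move: t1 t2 t3 y1 y2 e1 g1 g2; lra.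
move: L0; rewrite /L boxintD//; [|by cont..].
rewrite boxintZ//; last by cont.
rewrite boxintZ//; last by cont.
rewrite -/G -/(moment n.+2); lra.
Qed.

(** One factor w of the moment of order n + 2 is written as the curl of
(v1, v2), and the derivatives are moved to w^(n+1) phi^(n+2). Young's inequality
with the parameter tau, fitted to the constant of the energy estimate, absorbs
the gradient of w; the three factors A come from (v1, v2) twice and from that
constant once. *)
Lemma moment_step :
  moment n.+2 <= 4 * ((n%:R + 1) ^+ 2 * B + 8 * (n%:R + 2) ^+ 2) * (A ^+ 3 / r) * moment n.
Proof.
(* d2 (v1 w^(n+1) phi^(n+2)) - d1 (v2 w^(n+1) phi^(n+2)), with w in place of
   v12 - v21. *)
pose S z := (w z * phi z) ^+ n * ((w z * phi z) ^+ 2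
  + (n%:R + 1) * phi z ^+ 2 * (v1 z * w2 z - v2 z * w1 z)
  + (n%:R + 2) * (w z * phi z) * (v1 z * phi2 z - v2 z * phi1 z)).
have S0 : boxint r S = 0.
  have CF := C1N (C1M (C1M Cv2 (C1X n.+1 Cw)) (C1X n.+2 Cphi)).
  have CG := C1M (C1M Cv1 (C1X n.+1 Cw)) (C1X n.+2 Cphi).
  apply: (boxint_div r1 CF CG).
  - by move=> z; rewrite -/phi -/(phi z) => -> /=; rewrite expr0n /=; ring.
  - by move=> z; rewrite -/phi -/(phi z) => -> /=; rewrite expr0n /=; ring.
  move=> z /=; rewrite /S !exprS exprMn -!natr1.
  have -> : v12 z = w z + v21 z by rewrite w_curl; ring.
  by ring.
have Ar0 : 0 < A / r by rewrite divr_gt0.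
have B0 : 0 < B.
  by rewrite /B; have := sqr_ge0 (n%:R + 4 : R); lra.
pose tau := (4 * (B * (A / r)))^-1.
have BAr0 : 0 < B * (A / r) by rewrite mulr_gt0.
have tau0 : 0 < tau by rewrite invr_gt0 mulr_gt0.
have tauE : tau * (B * (A / r)) = 4^-1.
  by rewrite /tau invfM -mulrA mulVf ?mulr1// gt_eqF.
pose D := 2 * ((n%:R + 1) ^+ 2 * B + 8 * (n%:R + 2) ^+ 2) * (A ^+ 3 / r).
pose L z := (3 / 4) * (w z * phi z) ^+ n.+2
  + (- tau * ((w z * phi z) ^+ n * ((phi z ^+ 2 * w1 z) ^+ 2 + (phi z ^+ 2 * w2 z) ^+ 2))
   + - D * (w z * phi z) ^+ n).
have L0 : boxint r L <= 0.
  rewrite -S0; apply: boxint_le => //; rewrite /L /S; [cont|cont|].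
  move=> x y xr yr; set z := (x, y).
  have [/andP[p0 p1] q1 q2] := cutoff_bounds r1 xr yr.
  have [_ _ b1 b2] := bnd xr yr.
  rewrite -/phi -/phi1 -/phi2 -/z in p0 p1 q1 q2 b1 b2.
  rewrite [(_ * _) ^+ n.+2](_ : _ = (w z * phi z) ^+ n * (w z * phi z) ^+ 2); last first.
    by rewrite -exprD addn2.
  rewrite (mulrC (- D)) !(mulrCA _ ((w z * phi z) ^+ n)) -!mulrDr ler_wpM2l//.
    by rewrite exprn_even_ge0.
  have N0 : (0 : R) <= n%:R by [].
  have A3 : 0 < A ^+ 3 / r by rewrite divr_gt0 ?exprn_gt0.
  have r2 : (A / r) ^+ 2 <= A ^+ 3 / r.
    rewrite expr_div_n (exprSr A 2) -[leRHS]mulrA.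
    by rewrite ler_wpM2l ?sqr_ge0.
  have h1 := sqr_le_norm b1; have h2 := sqr_le_norm b2.
  have k1 : (v2 z * phi1 z) ^+ 2 <= 4 * (A ^+ 3 / r).
    rewrite exprMn; apply: le_trans (_ : A ^+ 2 * (2 / r) ^+ 2 <= _).
      by apply: ler_pM; rewrite ?sqr_ge0// sqr_le_norm.
    by rewrite -exprMn mulrCA exprMn (_ : 2 ^+ 2 = 4 :> R) ?ler_pM2l//; ring.
  have k2 : (v1 z * phi2 z) ^+ 2 <= 4 * (A ^+ 3 / r).
    rewrite exprMn; apply: le_trans (_ : A ^+ 2 * (2 / r) ^+ 2 <= _).
      by apply: ler_pM; rewrite ?sqr_ge0// sqr_le_norm.
    by rewrite -exprMn mulrCA exprMn (_ : 2 ^+ 2 = 4 :> R) ?ler_pM2l//; ring.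
  have E4 : (4 * tau)^-1 = B * (A / r).
    by rewrite /tau; field; rewrite ?gt_eqF.
  have E5 : A ^+ 2 * (A / r) = A ^+ 3 / r by rewrite (exprSr A 2) mulrA.
  move: h1 h2 k1 k2; rewrite /D.
  move: (phi z) (phi1 z) (phi2 z) (v1 z) (v2 z) (w z) (w1 z) (w2 z)
    => p f1 f2 V1 V2 W W1 W2 h1 h2 k1 k2.
  have y1 := @young_ge _ (p ^+ 2 * W1) (- (n%:R + 1) * V2) tau tau0.
  have y2 := @young_ge _ (p ^+ 2 * W2) ((n%:R + 1) * V1) tau tau0.
  have y3 := @young_ge _ (W * p) ((n%:R + 2) * (V1 * f2)) 8^-1 ltac:(lra).
  have y4 := @young_ge _ (W * p) (- (n%:R + 2) * (V2 * f1)) 8^-1 ltac:(lra).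
  have m1 : (- (n%:R + 1) * V2) ^+ 2 / (4 * tau) <= (n%:R + 1) ^+ 2 * B * (A ^+ 3 / r).
    rewrite E4 [leLHS](_ : _ = (n%:R + 1) ^+ 2 * (B * (V2 ^+ 2 * (A / r)))); last by ring.
    by rewrite -mulrA ler_wpM2l ?sqr_ge0// ler_pM2l// -E5 ler_pM2r.
  have m2 : ((n%:R + 1) * V1) ^+ 2 / (4 * tau) <= (n%:R + 1) ^+ 2 * B * (A ^+ 3 / r).
    rewrite E4 [leLHS](_ : _ = (n%:R + 1) ^+ 2 * (B * (V1 ^+ 2 * (A / r)))); last by ring.
    by rewrite -mulrA ler_wpM2l ?sqr_ge0// ler_pM2l// -E5 ler_pM2r.
  have m3 : ((n%:R + 2) * (V1 * f2)) ^+ 2 / (4 / 8) <= 8 * (n%:R + 2) ^+ 2 * (A ^+ 3 / r).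
    rewrite exprMn (_ : (4 / 8)^-1 = 2 :> R); last by field.
    have := ler_wpM2l (sqr_ge0 (n%:R + 2 : R)) k2; lra.
  have m4 : (- (n%:R + 2) * (V2 * f1)) ^+ 2 / (4 / 8) <= 8 * (n%:R + 2) ^+ 2 * (A ^+ 3 / r).
    rewrite exprMn sqrrN (_ : (4 / 8)^-1 = 2 :> R); last by field.
    have := ler_wpM2l (sqr_ge0 (n%:R + 2 : R)) k1; lra.
  move: y1 y2 y3 y4 m1 m2 m3 m4.
  set M1 := _ / (4 * tau); set M2 := _ / (4 * tau); set M3 := _ / (4 / 8); set M4 :=
    _ / (4 / 8).
  lra.
move: L0; rewrite /L boxintD//; [|by cont..].
rewrite boxintD//; [|by cont..].
rewrite boxintZ//; last by cont.
rewrite boxintZ//; last by cont.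
rewrite boxintZ//; last by cont.
rewrite -/G -/(moment n.+2) -/(moment n) /D.
have := ler_wpM2l (ltW tau0) caccioppoli; rewrite [leRHS]mulrA tauE; lra.
Qed.
End Step.

(** * A Liouville theorem for transported vorticities *)

Section Lower.
Variable R : realType.
Implicit Types (a b : R) (f g : R * R -> R).
Notation mu := (@lebesgue_measure R).

Lemma segint_lower a b c d (k : R) (f : R -> R) : continuous f ->
  (forall t, 0 <= f t) -> a <= c -> c <= d -> d <= b ->
  (forall t, c <= t <= d -> k <= f t) -> k * (d - c) <= segint a b f.
Proof.
move=> cf f0 ac cd db kf; rewrite -segint_cst//.
apply: (@le_trans _ _ (segint c d f)).
  by apply: segint_le => // t; exact: cvg_cst.
apply: fine_le.
- exact: integrable_fin_num (cont_integrable c d cf).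
- exact: integrable_fin_num (cont_integrable a b cf).
apply: ge0_subset_integral => //.
- by apply/measurable_EFinP; apply: measurable_funTS; exact: continuous_measurable_fun.
- by move=> x _; rewrite lee_fin.
- by apply: subset_itv; rewrite bnd_simp.
Qed.

Lemma boxint_lower r f (x0 y0 d k : R) : 0 < d -> continuous f ->
  (forall z, 0 <= f z) -> `|x0| + d <= r -> `|y0| + d <= r -> 0 <= k ->
  (forall x y, `|x - x0| <= d -> `|y - y0| <= d -> k <= f (x, y)) ->
  k * (d * 2) ^+ 2 <= boxint r f.
Proof.
move=> d0 cf f0 xr yr k0 kf.
have := ler_norm x0; have := ler_norm (- x0); rewrite normrN => n1 n2.
have := ler_norm y0; have := ler_norm (- y0); rewrite normrN => n3 n4.
have -> : k * (d * 2) ^+ 2 = k * (y0 + d - (y0 - d)) * (x0 + d - (x0 - d)) by ring.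
apply: segint_lower; try lra.
- by apply: segint_param_cont => //; lra.
- by move=> t; exact: segint_ge0.
move=> t td; apply: segint_lower => //; try lra.
- exact: slice2_cont.
by move=> s sd; apply: kf; rewrite ler_norml; lra.
Qed.

Lemma cont_square_lower f (x0 y0 : R) : continuous f -> f (x0, y0) != 0 ->
  exists2 d, 0 < d & forall x y, `|x - x0| <= d -> `|y - y0| <= d ->
    `|f (x0, y0)| / 2 <= `|f (x, y)|.
Proof.
move=> cf fn0.
have e0 : 0 < `|f (x0, y0)| / 2 by rewrite divr_gt0// normr_gt0.
have /cvgrPdist_lt /(_ _ e0) := cf (x0, y0).
rewrite nearE => /nbhs_ballP[e /= e_gt0 He].
exists (e / 2); first by rewrite divr_gt0.
move=> x y xd yd; have /= := He (x, y).
have h : ball (x0, y0) e (x, y).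
  by split; rewrite /= -ball_normE /= distrC; lra.
move=> /(_ h) H; have := ler_normD (f (x0, y0) - f (x, y)) (f (x, y)).
by rewrite subrK; lra.
Qed.

End Lower.

Section Liouville.
Variable R : realType.
Variables (alpha C : R).
Hypotheses (alpha_ge0 : 0 <= alpha) (alpha_lt : alpha < 3%:R^-1) (C1_le : 1 <= C).
Variables w w1 w2 w11 w12 w21 w22 : R * R -> R.
Variables a1 a11 a12 a2 a21 a22 v1 v11 v12 v2 v21 v22 : R * R -> R.
Hypotheses (Cw : C1 w w1 w2) (Cw1 : C1 w1 w11 w12) (Cw2 : C1 w2 w21 w22).
Hypotheses (Ca1 : C1 a1 a11 a12) (Ca2 : C1 a2 a21 a22).
Hypotheses (Cv1 : C1 v1 v11 v12) (Cv2 : C1 v2 v21 v22).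
Hypothesis transport : forall z, w11 z + w22 z = a1 z * w1 z + a2 z * w2 z.
Hypothesis div_free : forall z, a11 z + a22 z = 0.
Hypothesis w_curl : forall z, w z = v12 z - v21 z.
Hypothesis bnd : forall r x y, 1 <= r -> `|x| <= r -> `|y| <= r ->
  [/\ `|a1 (x, y)| <= C * r `^ alpha, `|a2 (x, y)| <= C * r `^ alpha,
      `|v1 (x, y)| <= C * r `^ alpha & `|v2 (x, y)| <= C * r `^ alpha].

(** Iterating [moment_step] from the moment of order 0, the area 4 r^2. *)
Lemma moment_iter (q : nat) : exists2 K : R, 0 <= K &
  forall r, 1 <= r ->
    moment r w (2 * q) <= K * ((C * r `^ alpha) ^+ 3 / r) ^+ q * r ^+ 2.
Proof.
elim: q => [|q [K K0 IH]].
  exists 4 => // r r1; rewrite /moment muln0 expr0 mulr1.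
  rewrite (_ : (fun z => _) = fun=> 1); last by apply/funext => z; rewrite expr0.
  by rewrite boxint_cst ?(lt_le_trans _ r1)//; lra.
have Aprop r : 1 <= r -> 1 <= C * r `^ alpha.
  move=> r1; rewrite -[leLHS]mulr1; apply: ler_pM => //.
  by rewrite -(powRr0 r) ler_powR.
have n_even : ~~ odd (2 * q) by rewrite mul2n odd_double.
have cst_ge0 : 0 <= 4 * (((2 * q)%:R + 1) ^+ 2 * (16 * (((2 * q)%:R + 4) ^+ 2 + 1))
  + 8 * ((2 * q)%:R + 2) ^+ 2) :> R.
  set m := (2 * q)%:R.
  have h0 : (0 : R) <= 16 * ((m + 4) ^+ 2 + 1) by have := sqr_ge0 (m + 4 : R); lra.
  have := mulr_ge0 (sqr_ge0 (m + 1)) h0; have := sqr_ge0 (m + 2 : R); lra.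
exists (4 * (((2 * q)%:R + 1) ^+ 2 * (16 * (((2 * q)%:R + 4) ^+ 2 + 1))
  + 8 * ((2 * q)%:R + 2) ^+ 2) * K).
  by rewrite mulr_ge0.
move=> r r1.
have -> : (2 * q.+1 = (2 * q).+2)%N by rewrite mulnS.
apply: le_trans (moment_step r1 (Aprop r r1) n_even Cw Cw1 Cw2 Ca1 Ca2 Cv1 Cv2
  transport div_free w_curl (fun x y => @bnd r x y r1)) _.
set X := 4 * _; set Q := _ / r.
have -> : X * K * Q ^+ q.+1 * r ^+ 2 = X * Q * (K * Q ^+ q * r ^+ 2).
  by rewrite exprS; ring.
rewrite ler_wpM2l ?IH// mulr_ge0//.
by rewrite /Q divr_ge0 ?exprn_ge0//; have := Aprop r r1; lra.
Qed.

(** Where w does not vanish, its moments are bounded below for large r. The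
moment of order 2 q is O(r^(2 - q (1 - 3 alpha))), hence O(1 / r) as soon as
q (1 - 3 alpha) >= 3. *)
Lemma transport_liouville z : w z = 0.
Proof.
apply/eqP/negPn/negP; case: z => x0 y0 wn0.
have cw : continuous w by case: Cw.
have [d d0 Hd] := cont_square_lower cw wn0.
have [q Hq] : exists q : nat, 3 <= q%:R * (1 - 3 * alpha).
  have g0 : 0 < 1 - 3 * alpha.
    by have := alpha_lt; rewrite -(ltr_pM2l (_ : 0 < 3))// divff//; lra.
  exists (Num.bound (3 / (1 - 3 * alpha))).
  rewrite -ler_pdivrMr//; apply: ltW; apply: archi_boundP.
  by rewrite divr_ge0// ltW.
have [K K0 HK] := moment_iter q.
set k := (`|w (x0, y0)| / 4) ^+ (2 * q).
have k0 : 0 < k by rewrite exprn_gt0// divr_gt0// normr_gt0.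
have kd0 : 0 < k * (d * 2) ^+ 2 by rewrite mulr_gt0// exprn_gt0//; lra.
have low r : 1 <= r -> 2 * (`|x0| + `|y0| + d) <= r ->
    k * (d * 2) ^+ 2 <= K * C ^+ (3 * q) / r.
  move=> r1 rlarge.
  have r0 : 0 < r by exact: lt_le_trans r1.
  have nx := normr_ge0 x0; have ny := normr_ge0 y0.
  apply: (@le_trans _ _ (moment r w (2 * q))).
    apply: (@boxint_lower _ _ _ x0 y0); rewrite ?ltW//; try lra.
    - have [cphi _ _ _ _] := C1_cutoff r1.
      by apply: (@contX _ (fun z => w z * cutoff r z)); exact: contM.
    - by move=> z; rewrite exprn_even_ge0// mul2n odd_double.
    move=> x y xd yd; rewrite exprM -normsq -exprM /k; apply: lerXn2r.
    - by rewrite nnegrE divr_ge0.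
    - by rewrite nnegrE.
    have hx := ler_normD (x - x0) x0; have hy := ler_normD (y - y0) y0.
    rewrite !subrK in hx hy.
    have c2 : 2^-1 <= cutoff r (x, y) by apply: cutoff_half => //; lra.
    rewrite normrM (ger0_norm (le_trans _ c2)); last by lra.
    rewrite (_ : `|w (x0, y0)| / 4 = `|w (x0, y0)| / 2 * 2^-1); last by field.
    by apply: ler_pM => //; exact: Hd.
  apply: le_trans (HK r r1) _.
  have -> : (C * r `^ alpha) ^+ 3 / r = C ^+ 3 * r `^ (3 * alpha - 1).
    rewrite exprMn -mulrA; congr (_ * _).
    rewrite -powR_mulrn ?powR_ge0// -powRrM -powR_inv1 ?ltW// -powRD; last first.
      by apply/implyP => _; rewrite gt_eqF.
    by rewrite mulrC.
  rewrite exprMn -exprM [leLHS](_ : _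
    = K * C ^+ (3 * q) * ((r `^ (3 * alpha - 1)) ^+ q * r ^+ 2)); last by ring.
  rewrite ler_wpM2l//; first by rewrite mulr_ge0// exprn_ge0//; move: C1_le; lra.
  rewrite -powR_mulrn ?powR_ge0// -powRrM.
  apply: (@le_trans _ _ (r `^ (- 3%:R) * r ^+ 2)).
    rewrite ler_wpM2r ?exprn_ge0 ?(ltW r0)// ler_powR//.
    by have := Hq; lra.
  rewrite (powR_invn _ (ltW r0)) le_eqVlt; apply/orP; left; apply/eqP.
  by field; rewrite gt_eqF.
set L := K * C ^+ (3 * q) in low.
have L0 : 0 <= L by rewrite mulr_ge0// exprn_ge0//; move: C1_le; lra.
set c := k * (d * 2) ^+ 2 in low kd0.
pose r := 1 + 2 * (`|x0| + `|y0| + d) + L / c.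
have nx := normr_ge0 x0; have ny := normr_ge0 y0.
have Lc : 0 <= L / c by rewrite divr_ge0// ltW.
have r0 : 0 < r by rewrite /r; lra.
have := low r; rewrite ler_pdivlMr//.
have e1 : 1 <= r by rewrite /r; lra.
have e2 : 2 * (`|x0| + `|y0| + d) <= r by rewrite /r; lra.
move=> /(_ e1 e2).
have : L < c * r.
  by rewrite mulrC -ltr_pdivrMr// /r; lra.
lra.
Qed.

End Liouville.

(** * Mixed partials, stream functions and interior maxima *)

Section OneVariable.
Variable R : realType.
Implicit Types (g : R -> R).

Lemma derive_continuous g g' : (forall t, is_derive t (1 : R) g (g' t)) ->
  continuous g.
Proof.
move=> dg t; apply: differentiable_continuous; apply/derivable1_diffP.
by have [] := dg t.
Qed.

Lemma mean_value g g' (a b : R) : (forall t, is_derive t (1 : R) g (g' t)) ->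
  a < b -> exists2 c, a < c < b & g b - g a = g' c * (b - a).
Proof.
move=> dg ab.
have cg : {within `[a, b], continuous g}.
  by apply: continuous_subspaceT; exact: derive_continuous dg.
have [c + ->] := MVT ab (fun t _ => dg t) cg.
by rewrite in_itv /= => abc; exists c.
Qed.

Lemma mean_value_bound g g' (a b M : R) : (forall t, is_derive t (1 : R) g (g' t)) ->
  (forall t, Num.min a b <= t <= Num.max a b -> `|g' t| <= M) ->
  `|g b - g a| <= M * `|b - a|.
Proof.
move=> dg; wlog : a b / a < b.
  move=> H Hb; have [ab|ba|->] := ltgtP a b.
  - exact: H.
  - by rewrite distrC (distrC b); apply: H => // t; rewrite minC maxC; exact: Hb.
  - by rewrite !subrr normr0 mulr0.
move=> ab Hb; have [c /andP[ac cb] ->] := mean_value dg ab.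
rewrite normrM ler_wpM2r// Hb// min_l ?max_r ?ltW//.
Qed.

(** If g2 were positive at the maximum t0, then g1 and therefore g would
increase to the right of t0: apply the mean value theorem twice. *)
Lemma second_derivative_at_max g g1 g2 (a b t0 : R) :
  (forall t, is_derive t (1 : R) g (g1 t)) ->
  (forall t, is_derive t (1 : R) g1 (g2 t)) -> continuous g2 ->
  a < t0 < b -> (forall t, a < t < b -> g t <= g t0) ->
  g1 t0 = 0 /\ g2 t0 <= 0.
Proof.
move=> dg dg1 cg2 /andP[at0 t0b] max0.
have g10 : g1 t0 = 0.
  have [_ <-] := dg t0.
  have [|t _|||_ ->//] := @derive1_at_max R g a b t0.
  - by rewrite ltW// (lt_trans at0).
  - by have [] := dg t.
  - by rewrite in_itv /= at0.
  - by move=> t; rewrite in_itv /=; exact: max0.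
split=> //; rewrite leNgt; apply/negP => g2pos.
have /cvgrPdist_lt /(_ _ g2pos) := cg2 t0.
rewrite nearE => /nbhs_ballP[e /= e0 He].
pose d := Num.min (e / 2) ((b - t0) / 2).
have d0 : 0 < d by rewrite lt_min !divr_gt0// subr_gt0.
have de : d < e by rewrite gt_min ltr_pdivrMr// ltr_pMr ?ltr1n.
have db : t0 + d < b.
  by apply: (@le_lt_trans _ _ (t0 + (b - t0) / 2)); [rewrite lerD2l ge_min lexx orbT|lra].
have [|c /andP[c1 c2] E1] := mean_value (a := t0) (b := t0 + d) dg; first by lra.
have [//|c' /andP[c1' c2'] E2] := mean_value (a := t0) (b := c) dg1.
have : 0 < g2 c'.
  have := He c'; rewrite -ball_normE /= => /(_ _) H.
  have : `|t0 - c'| < e by rewrite ltr_norml; lra.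
  by move=> /H; rewrite ltr_norml; lra.
move=> g2c'; have : 0 < g1 c.
  by have := mulr_gt0 g2c' (_ : 0 < c - t0); rewrite -E2 g10 subr0; apply; lra.
move=> g1c; have := mulr_gt0 g1c (_ : 0 < t0 + d - t0).
rewrite -E1 => H; have := H ltac:(lra); have := max0 (t0 + d); lra.
Qed.

(** Integrate g t * g over a short segment starting at t, where g is close to
g t: this product is nonnegative there whatever the sign of g t. *)
Lemma segint_all_eq0 g : continuous g ->
  (forall a b : R, a < b -> segint a b g = 0) -> forall t, g t = 0.
Proof.
move=> cg I0 t; apply/eqP/negPn/negP => gt0.
have e0 : 0 < `|g t| / 2 by rewrite divr_gt0// normr_gt0.
have /cvgrPdist_lt /(_ _ e0) := cg t.
rewrite nearE => /nbhs_ballP[e /= e_gt0 He].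
have tte : t < t + e / 2 by rewrite ltrDl divr_gt0.
have : 0 < g t ^+ 2 / 2 * (t + e / 2 - t).
  by rewrite mulr_gt0 ?subr_gt0// divr_gt0// lt_def sqr_ge0 sqrf_eq0 gt0.
have : segint t (t + e / 2) (fun s => g t * g s) = 0.
  by rewrite segintZ// I0// mulr0.
suff : g t ^+ 2 / 2 * (t + e / 2 - t) <= segint t (t + e / 2) (fun s => g t * g s).
  by lra.
rewrite -(segint_cst _ (ltW tte)); apply: segint_le.
- by move=> s; exact: cvg_cst.
- by move=> s; apply: cvgM; [exact: cvg_cst|exact: cg].
move=> s /andP[ts se]; have := He s; rewrite -ball_normE /= => H.
have {}H : `|g t - g s| < `|g t| / 2 by apply: H; rewrite ltr_norml; lra.
have : `|g t * (g t - g s)| <= `|g t| * (`|g t| / 2).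
  by rewrite normrM ler_wpM2l// ltW.
move=> /(le_trans (ler_norm _)).
by rewrite mulrA -expr2 normsq mulrBr -expr2; lra.
Qed.

(** The substitution s = t x in the integral of g from 0 to x: the segment of
integration no longer depends on x, and the formula is valid for both signs
of x. *)
Definition prim g (x : R) : R := segint 0 1 (fun t => x * g (t * x)).

Lemma is_derive_scale g g' (c x : R) : (forall t, is_derive t (1 : R) g (g' t)) ->
  is_derive x (1 : R) (fun x => g (c * x)) (c * g' (c * x)).
Proof.
move=> dg; rewrite mulrC.
have h : is_derive x (1 : R) (fun x => c * x) c.
  have := @is_deriveZ _ _ _ id c x (1 : R) (1 : R) _.
  by rewrite /GRing.scale /= mulr1; apply; exact: is_derive_id.
exact: (@is_derive1_comp _ g (fun x => c * x) x _ _ (dg (c * x)) h).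
Qed.

Lemma is_derive_scaler g g' (c x : R) : (forall t, is_derive t (1 : R) g (g' t)) ->
  is_derive x (1 : R) (fun x => g (x * c)) (c * g' (x * c)).
Proof.
move=> dg; rewrite (mulrC x).
have -> : (fun x => g (x * c)) = (fun x => g (c * x)).
  by apply/funext => y; rewrite mulrC.
exact: is_derive_scale.
Qed.

Lemma is_derive_mul_id g (l x : R) : is_derive x (1 : R) g l ->
  is_derive x (1 : R) (fun x => x * g x) (g x + x * l).
Proof.
move=> dg; have := is_deriveM (is_derive_id x (1 : R)) dg.
by rewrite /GRing.scale /= mulr1 addrC.
Qed.

(** The derivative with respect to x of x g(t x) equals the derivative with
respect to t of t g(t x), whose integral over [0, 1] is g x. *)
Lemma prim_derive g g' (x : R) : (forall t, is_derive t (1 : R) g (g' t)) ->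
  continuous g' -> is_derive x (1 : R) (prim g) (g x).
Proof.
move=> dg cg'; have cg := derive_continuous dg.
have cprod : continuous (fun z : R * R => z.2 * z.1).
  by apply: contM; [exact: cont_snd|exact: cont_fst].
have ccomp (k : R -> R) : continuous k -> continuous (fun z : R * R => k (z.2 * z.1)).
  by move=> ck z; apply: (continuous_comp (cprod z)); exact: ck.
pose F (z : R * R) := z.1 * g (z.2 * z.1).
pose F1 (z : R * R) := g (z.2 * z.1) + z.1 * (z.2 * g' (z.2 * z.1)).
have cF : continuous F by apply: contM; [exact: cont_fst|exact: ccomp].
have cF1 : continuous F1.
  apply: contD; first exact: ccomp.
  apply: contM; first exact: cont_fst.
  by apply: contM; [exact: cont_snd|exact: ccomp].
have dF z : is_derive z (@e1 R) F (F1 z).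
  case: z => y t; apply/is_derive_slice1; rewrite /F /F1 /=.
  by apply: is_derive_mul_id; exact: is_derive_scale.
have := @segint_param_derive R F F1 0 1 x cF cF1 dF ler01.
rewrite (_ : segint 0 1 _ = g x)//.
have dG t : is_derive t (1 : R) (fun t => t * g (t * x)) (F1 (x, t)).
  rewrite /F1 /= mulrCA; apply: is_derive_mul_id; exact: is_derive_scaler.
rewrite (segint_FTC ltr01 _ dG) ?mul1r ?mul0r ?subr0//.
exact: slice2_cont.
Qed.

End OneVariable.

Section TwoVariables.
Variable R : realType.
Implicit Types f : R * R -> R.

(** Locally bounded partial derivatives make f locally Lipschitz. *)
Lemma cont_of_partials f f1 f2 : continuous f1 -> continuous f2 ->
  (forall z, is_derive z (@e1 R) f (f1 z)) ->
  (forall z, is_derive z (@e2 R) f (f2 z)) -> continuous f.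
Proof.
move=> cf1 cf2 df1 df2 -[x y].
have [||M HM] := @box_bounded R f1 (x - 1) (x + 1) (y - 1) (y + 1) cf1; try lra.
have [||N HN] := @box_bounded R f2 (x - 1) (x + 1) (y - 1) (y + 1) cf2; try lra.
have M0 : 0 <= M by apply: le_trans (HM x y _ _); rewrite ?normr_ge0//; lra.
have N0 : 0 <= N by apply: le_trans (HN x y _ _); rewrite ?normr_ge0//; lra.
apply/cvgrPdist_lt => e e0.
pose d := Num.min 1 (e / (2 * (M + N + 1))).
have S0 : 0 < 2 * (M + N + 1) by lra.
have d0 : 0 < d by rewrite lt_min ltr01 divr_gt0.
have d1 : d <= 1 by rewrite ge_min lexx.
have d2 : d * (2 * (M + N + 1)) <= e by rewrite -ler_pdivlMr// ge_min lexx orbT.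
apply: filterS (nbhsx_ballx (x, y) d d0) => -[x' y'] [/=].
rewrite -!ball_normE /= => xd yd.
have /andP[x1 x2] : - d < x - x' < d by rewrite -ltr_norml.
have /andP[y1 y2] : - d < y - y' < d by rewrite -ltr_norml.
have b1 : `|f (x, y) - f (x', y)| <= M * `|x - x'|.
  apply: (@mean_value_bound _ (fun t => f (t, y)) (fun t => f1 (t, y))).
    by move=> t; apply/is_derive_slice1.
  move=> t /andP[]; rewrite ge_min le_max => t1 t2; apply: HM; last lra.
  by apply/andP; split; [case/orP: t1|case/orP: t2]; lra.
have b2 : `|f (x', y) - f (x', y')| <= N * `|y - y'|.
  apply: (@mean_value_bound _ (fun t => f (x', t)) (fun t => f2 (x', t))).
    by move=> t; apply/is_derive_slice2.
  move=> t /andP[]; rewrite ge_min le_max => t1 t2; apply: HN; first lra.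
  by apply/andP; split; [case/orP: t1|case/orP: t2]; lra.
have b3 : M * `|x - x'| <= M * d by rewrite ler_wpM2l// ltW.
have b4 : N * `|y - y'| <= N * d by rewrite ler_wpM2l// ltW.
have := ler_distD (f (x', y)) (f (x, y)) (f (x', y')); lra.
Qed.

(** On every vertical segment the integrals of f12 and f21 agree: both are the
difference of f1 between the ends, the latter by differentiating the integral
of f2 under the integral sign. *)
Lemma mixed_partials f f1 f2 f11 f12 f21 f22 :
  C1 f f1 f2 -> C1 f1 f11 f12 -> C1 f2 f21 f22 -> f12 =1 f21.
Proof.
move=> Cf Cf1 Cf2 [x y].
have [cf cf1 cf2 df1 df2] := Cf.
have [_ cf11 cf12 df11 df12] := Cf1.
have [_ cf21 cf22 df21 df22] := Cf2.
apply/eqP; rewrite -subr_eq0; apply/eqP; move: y.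
apply: (@segint_all_eq0 _ (fun y => f12 (x, y) - f21 (x, y))).
  by move=> y; exact: (cvgB (@slice2_cont _ _ x cf12 y) (@slice2_cont _ _ x cf21 y)).
move=> a b ab.
have c21 := @slice2_cont _ _ x cf21; have c12 := @slice2_cont _ _ x cf12.
rewrite (_ : (fun y => _) = (fun y => f12 (x, y) + (-1) * f21 (x, y))); last first.
  by apply/funext => y; rewrite mulN1r.
rewrite segintD ?segintZ//; last first.
  by move=> y; apply: cvgM; [exact: cvg_cst|exact: c21].
have dY t : is_derive t (1 : R) (fun t => f1 (x, t)) (f12 (x, t)).
  by apply/is_derive_slice2.
rewrite (segint_FTC ab c12 dY).
have dI : is_derive x (1 : R) (fun x => segint a b (fun y => f2 (x, y)))
    (segint a b (fun y => f21 (x, y))).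
  by apply: segint_param_derive => //; exact: ltW.
have E : (fun x => segint a b (fun y => f2 (x, y))) = (fun x => f (x, b) - f (x, a)).
  apply/funext => s; apply: (@segint_FTC _ _ _ (fun t => f (s, t))) => //.
    exact: slice2_cont.
  by move=> t; apply/is_derive_slice2.
rewrite E in dI.
have dI' : is_derive x (1 : R) (fun x => f (x, b) - f (x, a)) (f1 (x, b) - f1 (x, a)).
  have hb : is_derive x (1 : R) (fun x => f (x, b)) (f1 (x, b)) by apply/is_derive_slice1.
  have ha : is_derive x (1 : R) (fun x => f (x, a)) (f1 (x, a)) by apply/is_derive_slice1.
  exact: (is_deriveB hb ha).
have [_ <-] := dI; have [_ ->] := dI'.
by rewrite mulN1r subrr.
Qed.

(** psi integrates p along the second axis, then - q horizontally. Its second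
partial derivative is p by differentiation under the integral sign and
q2 = - p1. *)
Lemma stream_function (p p1 p2 q q1 q2 : R * R -> R) : C1 p p1 p2 -> C1 q q1 q2 ->
  (forall z, p1 z + q2 z = 0) -> exists psi, C1 psi (fun z => - q z) p.
Proof.
move=> [cp cp1 cp2 dp1 dp2] [cq cq1 cq2 dq1 dq2] div0.
pose psi (z : R * R) := prim (fun t => p (0, t)) z.2 - prim (fun s => q (s, z.2)) z.1.
have cNq : continuous (fun z => - q z) by exact: contN.
have D1 z : is_derive z (@e1 R) psi (- q z).
  case: z => x y; apply/is_derive_slice1; rewrite /psi /=.
  have h : is_derive x (1 : R) (prim (fun s => q (s, y))) (q (x, y)).
    apply: (@prim_derive _ (fun s => q (s, y)) (fun s => q1 (s, y))).
      by move=> t; apply/is_derive_slice1.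
    exact: slice1_cont.
  have := is_deriveB (is_derive_cst (prim (fun t => p (0, t)) y) x (1 : R)) h.
  by rewrite sub0r.
have D2 z : is_derive z (@e2 R) psi (p z).
  case: z => x y; apply/is_derive_slice2; rewrite /psi /=.
  have h1 : is_derive y (1 : R) (prim (fun t => p (0, t))) (p (0, y)).
    apply: (@prim_derive _ (fun t => p (0, t)) (fun t => p2 (0, t))).
      by move=> t; apply/is_derive_slice2.
    exact: slice2_cont.
  have csc : continuous (fun z : R * R => (z.2 * x, z.1)).
    have c1 : continuous (fun z : R * R => z.2 * x).
      by apply: contM; [exact: cont_snd|exact: cont_cst].
    have c2 : continuous (fun z : R * R => z.1) by exact: cont_fst.
    by move=> z; exact: (@cvg_pair _ _ _ _ _ _ _ _ _ _ _ (c1 z) (c2 z)).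
  have h2 : is_derive y (1 : R) (fun y => prim (fun s => q (s, y)) x)
    (- (p (x, y) - p (0, y))).
    pose F (z : R * R) := x * q (z.2 * x, z.1).
    pose F1 (z : R * R) := x * q2 (z.2 * x, z.1).
    have cF : continuous F.
      apply: contM; first exact: cont_cst.
      by move=> z; apply: (continuous_comp (csc z)); exact: cq.
    have cF1 : continuous F1.
      apply: contM; first exact: cont_cst.
      by move=> z; apply: (continuous_comp (csc z)); exact: cq2.
    have dF z : is_derive z (@e1 R) F (F1 z).
      case: z => s t; apply/is_derive_slice1; rewrite /F /F1 /=.
      have h : is_derive s (1 : R) (fun s => q (t * x, s)) (q2 (t * x, s)).
        by apply/is_derive_slice2.
      exact: (is_deriveZ x h).
    have := @segint_param_derive R F F1 0 1 y cF cF1 dF ler01.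
    rewrite (_ : segint 0 1 _ = - (p (x, y) - p (0, y)))//.
    have dG t : is_derive t (1 : R) (fun t => - p (t * x, y)) (F1 (y, t)).
      rewrite /F1 /= (_ : q2 _ = - p1 (t * x, y)); last first.
        by apply/eqP; rewrite -addr_eq0 addrC div0.
      rewrite mulrN; apply: is_deriveN.
      apply: (@is_derive_scaler _ (fun s => p (s, y)) (fun s => p1 (s, y))).
      by move=> s; apply/is_derive_slice1.
    rewrite (segint_FTC ltr01 _ dG); last exact: slice2_cont.
    by rewrite mul1r mul0r opprD.
  have := is_deriveB h1 h2.
  by rewrite opprK addrCA subrr addr0.
by exists psi; split=> //; exact: cont_of_partials cNq cp D1 D2.
Qed.

Lemma grad0_const f : (forall z, is_derive z (@e1 R) f 0) ->
  (forall z, is_derive z (@e2 R) f 0) -> forall z z', f z = f z'.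
Proof.
move=> d1 d2 [x y] [x' y'].
have -> : f (x, y) = f (x', y).
  by apply: (@is_derive_0_is_cst _ (fun t => f (t, y))) => t; apply/is_derive_slice1.
by apply: (@is_derive_0_is_cst _ (fun t => f (x', t))) => t; apply/is_derive_slice2.
Qed.

(** Second-order conditions hold at a maximum over a rectangle, unless it is
reached on the border. *)
Lemma box_max (v v1 v2 v11 v12 v21 v22 : R * R -> R) (a b c d : R) :
  C1 v v1 v2 -> C1 v1 v11 v12 -> C1 v2 v21 v22 -> a <= b -> c <= d ->
  exists x y, [/\ a <= x <= b, c <= y <= d,
    forall x' y', a <= x' <= b -> c <= y' <= d -> v (x', y') <= v (x, y) &
    [\/ x = a, x = b, y = c | y = d] \/
    [/\ v1 (x, y) = 0, v2 (x, y) = 0 & v11 (x, y) + v22 (x, y) <= 0]].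
Proof.
move=> [cv _ _ dv1 dv2] [_ cv11 _ dv11 _] [_ _ cv22 _ dv22] ab cd.
have [] := @compact_EVT_max _ R v (`[a, b] `*` `[c, d]).
- by exists (a, c); split; rewrite /= in_itv /= lexx.
- by apply: compact_setX; exact: segment_compact.
- exact: continuous_subspaceT.
move=> -[x y]; rewrite inE /= !in_itv /= => -[xab ycd] Hmax.
have {}Hmax x' y' : a <= x' <= b -> c <= y' <= d -> v (x', y') <= v (x, y).
  by move=> x'ab y'cd; apply: Hmax; rewrite inE /=; split; rewrite /= in_itv.
exists x, y; split=> //.
have [->|xa] := eqVneq x a; first by left; constructor.
have [->|xb] := eqVneq x b; first by left; constructor.
have [->|yc] := eqVneq y c; first by left; constructor.
have [->|yd] := eqVneq y d; first by left; constructor.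
have ax : a < x < b.
  by case/andP: xab => h1 h2; rewrite !lt_neqAle h1 h2 xb eq_sym xa.
have cy : c < y < d.
  by case/andP: ycd => h1 h2; rewrite !lt_neqAle h1 h2 yd eq_sym yc.
right.
have [|||||E1 L1] := @second_derivative_at_max _ (fun t => v (t, y))
    (fun t => v1 (t, y)) (fun t => v11 (t, y)) a b x.
- by move=> t; apply/is_derive_slice1.
- by move=> t; apply/is_derive_slice1.
- exact: slice1_cont.
- exact: ax.
- by move=> t /andP[h1 h2]; apply: Hmax => //; rewrite !ltW.
have [|||||E2 L2] := @second_derivative_at_max _ (fun t => v (x, t))
    (fun t => v2 (x, t)) (fun t => v22 (x, t)) c d y.
- by move=> t; apply/is_derive_slice2.
- by move=> t; apply/is_derive_slice2.
- exact: slice2_cont.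
- exact: cy.
- by move=> t /andP[h1 h2]; apply: Hmax => //; rewrite !ltW.
by split=> //; lra.
Qed.

End TwoVariables.

(** * Maximum principles *)

Section MaxPrinciple.
Variable R : realType.

Lemma C1_expR (l : R) : C1 (fun z : R * R => expR (l * z.1))
  (fun z => l * expR (l * z.1)) (fun=> 0).
Proof.
have cl : continuous (fun z : R * R => l * z.1).
  by apply: contM; [exact: cont_cst|exact: cont_fst].
have cE : continuous (fun z : R * R => expR (l * z.1)).
  by move=> z; apply: (continuous_comp (cl z)); exact: continuous_expR.
split=> //.
- by apply: contM => //; exact: cont_cst.
- exact: cont_cst.
- move=> -[x y]; apply/is_derive_slice1 => /=.
  apply: (@is_derive_scale _ expR expR) => t; exact: is_derive_expR.
- by move=> -[x y]; apply/is_derive_slice2 => /=; exact: is_derive_cst.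
Qed.

Definition on_border (a b c d x y : R) := [\/ x = a, x = b, y = c | y = d].

(** A small multiple of exp (l z.1), with l larger than the drift on the
rectangle, turns v into a strict subsolution, whose maximum cannot be
interior. *)
Lemma max_principle (v v1 v2 v11 v12 v21 v22 a1 a2 : R * R -> R) (a b c d m : R) :
  C1 v v1 v2 -> C1 v1 v11 v12 -> C1 v2 v21 v22 -> continuous a1 ->
  a <= b -> c <= d ->
  (forall z, v11 z + v22 z = a1 z * v1 z + a2 z * v2 z) ->
  (forall x y, a <= x <= b -> c <= y <= d -> on_border a b c d x y -> v (x, y) <= m) ->
  forall x y, a <= x <= b -> c <= y <= d -> v (x, y) <= m.
Proof.
move=> Cv Cv1 Cv2 ca1 ab cd eqn bdry x y xab ycd.
have [M HM] := box_bounded ca1 ab cd.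
pose l := M + 1.
have l0 : 0 < l.
  have : 0 <= M by apply: le_trans (HM x y xab ycd); exact: normr_ge0.
  by rewrite /l; lra.
have key e : 0 < e -> v (x, y) <= m + e * expR (l * b).
  move=> e0.
  have CE := C1M (C1_cst e) (C1_expR l).
  have C0E := C1M (C1_cst 0) (C1_expR l).
  have Cw := C1D Cv CE.
  have Cw1 := C1D Cv1 (C1D C0E (C1M (C1_cst e) (C1M (C1_cst l) (C1_expR l)))).
  have Cw2 := C1D Cv2 (C1D C0E (C1M (C1_cst e) (C1_cst 0))).
  have [x' [y' [x'ab y'cd Hmax Hcase]]] := box_max Cw Cw1 Cw2 ab cd.
  have E0 : 0 < expR (l * x') by exact: expR_gt0.
  have vle : v (x, y) <= v (x', y') + e * expR (l * x').
    apply: le_trans (Hmax x y xab ycd).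
    by rewrite lerDl mulr_ge0 ?expR_ge0// ltW.
  case: Hcase => [bd|[/= g1 g2 L]].
    apply: le_trans vle _; apply: lerD; first exact: bdry.
    rewrite ler_pM2l// ler_expR ler_pM2l//.
    by case/andP: x'ab.
  exfalso.
  have a1l : a1 (x', y') <= M.
    by apply: le_trans (HM x' y' x'ab y'cd); exact: ler_norm.
  have := eqn (x', y').
  have -> : v1 (x', y') = - (e * (l * expR (l * x'))) by lra.
  have -> : v2 (x', y') = 0 by lra.
  move=> eqn'.
  have P0 : 0 < e * (l * expR (l * x')) by rewrite !mulr_gt0.
  have : 0 < e * (l * expR (l * x')) * (l - a1 (x', y')).
    by rewrite mulr_gt0// /l; lra.
  lra.
rewrite leNgt; apply/negP => mv.
have E0 : 0 < expR (l * b) by exact: expR_gt0.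
have e0 : 0 < (v (x, y) - m) / (2 * expR (l * b)).
  by rewrite divr_gt0 ?subr_gt0// mulr_gt0.
have := key _ e0.
have -> : (v (x, y) - m) / (2 * expR (l * b)) * expR (l * b) = (v (x, y) - m) / 2.
  by field; rewrite gt_eqF.
lra.
Qed.

(** On a square of half-width L inside the half-plane, subtract from v the
paraboloid k |z - z0|^2 / 8 centred at the centre z0. The Laplacian stays
positive, so the maximum is on the border, where v has gained at most 2 B L
and lost at least k L^2 / 8: impossible for large L. *)
Lemma no_source (v v1 v2 v11 v12 v21 v22 : R * R -> R) (B k L0 : R) :
  C1 v v1 v2 -> C1 v1 v11 v12 -> C1 v2 v21 v22 -> 0 < k ->
  (forall z, `|v1 z| <= B) -> (forall z, `|v2 z| <= B) ->
  (forall x y, L0 <= x -> k <= v11 (x, y) + v22 (x, y)) -> False.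
Proof.
move=> Cv Cv1 Cv2 k0 b1 b2 src.
have B0 : 0 <= B by apply: le_trans (b1 (0, 0)).
pose L := 16 * B / k + 1; pose X := L0 + L.
have L1 : 0 < L by rewrite /L ltr_wpDl// divr_ge0 ?mulr_ge0// ltW.
have Cq1 : C1 (fun z : R * R => z.1 + - X) _ _ := C1D (C1_fst R) (C1_cst (- X)).
have Cq : C1 (fun z : R * R => - (k / 8) * ((z.1 + - X) ^+ 2 + z.2 ^+ 2))
    (fun z => - (k / 4) * (z.1 + - X)) (fun z => - (k / 4) * z.2).
  by apply: (C1_eq (C1M (C1_cst (- (k / 8))) (C1D (C1X 2 Cq1) (C1X 2 (C1_snd R))))) => z
    //=;
    field.
have Cw := C1D Cv Cq.
have Cw1 := C1D Cv1 (C1M (C1_cst (- (k / 4))) Cq1).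
have Cw2 := C1D Cv2 (C1M (C1_cst (- (k / 4))) (C1_snd R)).
have [||x [y [xb yb Hmax Hcase]]] := box_max (a := X - L) (b := X + L) (c := - L) (d := L)
  Cw Cw1 Cw2; try lra.
have := Hmax X 0 ltac:(lra) ltac:(lra) => /=.
case: Hcase => [bd|[_ _ /=]]; last first.
  have := src x y; rewrite /X in xb; move=> /(_ ltac:(lra)); lra.
have d1 : `|v (x, y) - v (X, y)| <= B * `|x - X|.
  case: Cv => _ _ _ dv1 _.
  apply: (@mean_value_bound _ (fun t => v (t, y)) (fun t => v1 (t, y))) => //.
  by move=> t; apply/is_derive_slice1.
have d2 : `|v (X, y) - v (X, 0)| <= B * `|y - 0|.
  case: Cv => _ _ _ _ dv2.
  apply: (@mean_value_bound _ (fun t => v (X, t)) (fun t => v2 (X, t))) => //.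
  by move=> t; apply/is_derive_slice2.
have n1 : `|x - X| <= L by rewrite ler_norml; lra.
have n2 : `|y - 0| <= L by rewrite ler_norml; lra.
have m1 := ler_wpM2l B0 n1; have m2 := ler_wpM2l B0 n2.
have sq : L ^+ 2 <= (x + - X) ^+ 2 + y ^+ 2.
  by case: bd => ->; have := sqr_ge0 y; have := sqr_ge0 (x + - X); lra.
have := ler_norm (v (x, y) - v (X, y)); have := ler_norm (v (X, y) - v (X, 0)).
have h1 : k / 8 * L ^+ 2 <= k / 8 * ((x + - X) ^+ 2 + y ^+ 2) by rewrite ler_wpM2l//; lra.
have h2 : k * L = 16 * B + k by rewrite /L; field; rewrite gt_eqF.
have h3 : k / 8 * L ^+ 2 = 2 * B * L + k / 8 * L.
  have -> : k / 8 * L ^+ 2 = (k * L) * L / 8 by field.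
  by rewrite h2; field.
have h4 : 0 < k / 8 * L by rewrite mulr_gt0// divr_gt0.
move: h1; rewrite h3; lra.
Qed.

End MaxPrinciple.

(** * Measurability and lines carrying little mass *)

Section Lines.
Variable R : realType.
Notation mu := (@lebesgue_measure R).

(** An open set is the countable union of the squares with rational centre and
half-width that it contains. *)
Lemma open_measurable2 (U : set (R * R)) : open U ->
  measurable (U : set (measurableTypeR R * measurableTypeR R)).
Proof.
move=> oU.
pose sq (p q e : rat) : set (R * R) :=
  `]ratr p - ratr e, ratr p + ratr e[ `*` `]ratr q - ratr e, ratr q + ratr e[.
pose S p q e := if `[< sq p q e `<=` U >] then sq p q e else set0.
have -> : U = \bigcup_p \bigcup_q \bigcup_e S p q e.
  apply/seteqP; split=> [[x y] Uz|z [p _ [q _ [e _]]]]; last first.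
    by rewrite /S; case: asboolP => // + h; apply.
  have /nbhs_ballP[r /= r0 Hr] : nbhs (x, y) U by exact: open_nbhs_nbhs.
  have [e] := @rat_in_itvoo R 0 (r / 2) ltac:(lra).
  rewrite in_itv /= => /andP[e0 er].
  have [p] := @rat_in_itvoo R (x - ratr e) (x + ratr e) ltac:(lra).
  have [q] := @rat_in_itvoo R (y - ratr e) (y + ratr e) ltac:(lra).
  rewrite !in_itv /= => /andP[q1 q2] /andP[p1 p2].
  exists p => //; exists q => //; exists e => //; rewrite /S.
  case: asboolP => [_|].
    by split; rewrite /= in_itv /=; lra.
  case=> -[x' y'] [/=]; rewrite !in_itv /= => /andP[x1 x2] /andP[y1 y2].
  by apply: Hr; split; rewrite /= -ball_normE /= ltr_norml; lra.
apply: bigcupT_measurable_rat => p; apply: bigcupT_measurable_rat => q.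
apply: bigcupT_measurable_rat => e; rewrite /S.
case: ifP => _; last exact: measurable0.
by apply: measurableX; exact: measurable_itv.
Qed.

Lemma cont_measurable2 (f : R * R -> R) : continuous f ->
  measurable_fun [set: measurableTypeR R * measurableTypeR R] f.
Proof.
move=> cf; apply: (measurability _ (RGenOInfty.measurableE R)).
move=> _ [_ [x ->] <-]; rewrite setTI; apply: open_measurable2.
by move/continuousP : cf; apply; exact: interval_open.
Qed.

Lemma small_value (F : R -> \bar R) (D : set R) (del : R) :
  measurable_fun setT F -> (forall x, 0 <= F x)%E ->
  (\int[mu]_x F x < +oo)%E -> measurable D -> mu D = +oo%E -> 0 < del ->
  exists2 s, D s & (F s <= del%:E)%E.
Proof.
move=> mF F0 Foo mD Doo del0; apply: contrapT => H.
have {}H s : D s -> (del%:E <= F s)%E.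
  move=> Ds; rewrite leNgt; apply/negP => Fs; apply: H; exists s => //.
  exact: ltW.
have : (\int[mu]_(x in D) (cst del%:E) x <= \int[mu]_x F x)%E.
  apply: (@le_trans _ _ (\int[mu]_(x in D) F x)%E).
    apply: ge0_le_integral => //.
    - by move=> x _; rewrite lee_fin ltW.
    - exact: measurable_funTS.
  by apply: ge0_subset_integral.
rewrite integral_cst//= Doo gt0_muley ?lte_fin//.
by move=> /(lt_le_trans Foo); rewrite ltxx.
Qed.

Lemma segint_le_integral (a b del : R) (g k : R -> R) : continuous g -> continuous k ->
  (forall t, `|g t| <= k t) -> (\int[mu]_t (k t)%:E <= del%:E)%E ->
  `|segint a b g| <= del.
Proof.
move=> cg ck gk kd.
apply: (@le_trans _ _ (segint a b (fun t => `|g t|))).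
  by apply: le_normr_Rintegral => //; exact: cont_integrable.
have cng : continuous (fun t => `|g t|).
  by move=> t; apply: (continuous_comp (cg t)); exact: norm_continuous.
apply: (@le_trans _ _ (segint a b k)).
  by apply: segint_le.
rewrite -lee_fin /segint /Rintegral fineK; last first.
  exact: integrable_fin_num (cont_integrable a b ck).
apply: le_trans kd; apply: ge0_subset_integral => //.
  by apply/measurable_EFinP; exact: continuous_measurable_fun.
by move=> x _; rewrite lee_fin (le_trans _ (gk x)).
Qed.

End Lines.

(** * Flatness of a stream function with integrable gradient *)

Section Flat.
Variable R : realType.
Notation mu := (@lebesgue_measure R).

(** A line integral which exceeded del on a whole half-line of abscissae (or
ordinates) would have an infinite integral. *)
Lemma small_lines (g : R * R -> R) (N del : R) : continuous g ->
  (forall z, 0 <= g z) -> (\int[@lebesgue2 R]_z (g z)%:E < +oo)%E -> 0 < del ->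
  exists s1 s2 t1 t2, [/\ s1 <= - N, N <= s2, t1 <= - N & N <= t2] /\
    [/\ (\int[mu]_y (g (s1, y))%:E <= del%:E)%E,
        (\int[mu]_y (g (s2, y))%:E <= del%:E)%E,
        (\int[mu]_x (g (x, t1))%:E <= del%:E)%E &
        (\int[mu]_x (g (x, t2))%:E <= del%:E)%E].
Proof.
move=> cg g0 goo del0.
pose f (z : measurableTypeR R * measurableTypeR R) : \bar R := (g z)%:E.
have mf : measurable_fun setT f.
  by apply/measurable_EFinP; exact: cont_measurable2.
have f0 z : (0 <= f z)%E by rewrite lee_fin.
have m1 := measurable_fun_fubini_tonelli_F (m2 := mu) f mf f0.
have m2 := measurable_fun_fubini_tonelli_G (m1 := mu) f mf f0.
have i1 := fubini_tonelli1 (m1 := mu) (m2 := mu) f mf f0.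
have i2 := fubini_tonelli2 (m1 := mu) (m2 := mu) f mf f0.
have p1 x : (0 <= fubini_F mu f x)%E by exact: integral_ge0.
have p2 x : (0 <= fubini_G mu f x)%E by exact: integral_ge0.
have fin1 : (\int[mu]_x fubini_F mu f x < +oo)%E by rewrite -i1.
have fin2 : (\int[mu]_x fubini_G mu f x < +oo)%E by rewrite -i2.
have right_oo : mu `[N, +oo[ = +oo%E by rewrite lebesgue_measure_itv /= ltry.
have left_oo : mu `]-oo, (- N)] = +oo%E by rewrite lebesgue_measure_itv /= ltNyr.
have [s1 S1 hs1] := small_value m1 p1 fin1 (measurable_itv _) left_oo del0.
have [s2 S2 hs2] := small_value m1 p1 fin1 (measurable_itv _) right_oo del0.
have [t1 T1 ht1] := small_value m2 p2 fin2 (measurable_itv _) left_oo del0.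
have [t2 T2 ht2] := small_value m2 p2 fin2 (measurable_itv _) right_oo del0.
exists s1, s2, t1, t2; split; last by split.
by move: S1 S2 T1 T2; rewrite /= !in_itv /= !andbT.
Qed.

(** The lines of [small_lines] bound a rectangle containing (0, 0) and z, on
whose border v is within 2 del of its value k at a corner, since at most two
sides lead there. *)
Lemma integrable_gradient_flat (v v1 v2 v11 v12 v21 v22 a1 a2 g : R * R -> R) :
  C1 v v1 v2 -> C1 v1 v11 v12 -> C1 v2 v21 v22 -> continuous a1 -> continuous g ->
  (forall z, v11 z + v22 z = a1 z * v1 z + a2 z * v2 z) ->
  (forall z, `|v1 z| <= g z) -> (forall z, `|v2 z| <= g z) ->
  (\int[@lebesgue2 R]_z (g z)%:E < +oo)%E -> forall z, v z = v (0, 0).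
Proof.
move=> Cv Cv1 Cv2 ca1 cg eqn b1 b2 goo [x y].
have g0 z : 0 <= g z by apply: le_trans (b1 z).
have [_ cv1 cv2 dv1 dv2] := Cv.
suff H del : 0 < del -> `|v (x, y) - v (0, 0)| <= 4 * del.
  apply/eqP; rewrite -subr_eq0 -normr_eq0 eq_le normr_ge0 andbT.
  apply/ler_addgt0Pr => e e0; rewrite add0r.
  by have := H (e / 4) ltac:(lra); lra.
move=> del0.
have [s1 [s2 [t1 [t2 [[S1 S2 T1 T2] [hs1 hs2 ht1 ht2]]]]]] :=
  small_lines (`|x| + `|y|) cg g0 goo del0.
have nx := normr_ge0 x; have ny := normr_ge0 y.
have := ler_norm x; have := ler_norm (- x); rewrite normrN => x1 x2.
have := ler_norm y; have := ler_norm (- y); rewrite normrN => y1 y2.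
have s12 : s1 <= s2 by lra.
have t12 : t1 <= t2 by lra.
have vert s p q : (\int[mu]_y (g (s, y))%:E <= del%:E)%E -> p <= q ->
    `|v (s, q) - v (s, p)| <= del.
  move=> hs; rewrite le_eqVlt => /predU1P[->|pq]; first by rewrite subrr normr0 ltW.
  have dy t : is_derive t (1 : R) (fun t => v (s, t)) (v2 (s, t)).
    by apply/is_derive_slice2.
  rewrite -(segint_FTC pq (@slice2_cont _ _ s cv2) dy).
  apply: (@segint_le_integral R p q del _ (fun t => g (s, t))) => //; exact: slice2_cont.
have hori t p q : (\int[mu]_x (g (x, t))%:E <= del%:E)%E -> p <= q ->
    `|v (q, t) - v (p, t)| <= del.
  move=> hs; rewrite le_eqVlt => /predU1P[->|pq]; first by rewrite subrr normr0 ltW.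
  have dx s : is_derive s (1 : R) (fun s => v (s, t)) (v1 (s, t)).
    by apply/is_derive_slice1.
  rewrite -(segint_FTC pq (@slice1_cont _ _ t cv1) dx).
  apply: (@segint_le_integral R p q del _ (fun s => g (s, t))) => //; exact: slice1_cont.
pose k := v (s1, t1).
have bd p q : s1 <= p <= s2 -> t1 <= q <= t2 -> on_border s1 s2 t1 t2 p q ->
    `|v (p, q) - k| <= 2 * del.
  move=> /andP[p1 p2] /andP[q1 q2]; rewrite /k; case=> ->.
  - by have := vert s1 t1 q hs1 q1; lra.
  - have := vert s2 t1 q hs2 q1; have := hori t1 s1 s2 ht1 s12.
    by have := ler_distD (v (s2, t1)) (v (s2, q)) (v (s1, t1)); lra.
  - by have := hori t1 s1 p ht1 p1; lra.
  - have := hori t2 s1 p ht2 p1; have := vert s1 t1 t2 hs1 t12.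
    by have := ler_distD (v (s1, t2)) (v (p, t2)) (v (s1, t1)); lra.
have up p q : s1 <= p <= s2 -> t1 <= q <= t2 -> v (p, q) <= k + 2 * del.
  apply: (max_principle Cv Cv1 Cv2 ca1 s12 t12 eqn) => p' q' h1 h2 h3.
  by have := bd p' q' h1 h2 h3; rewrite ler_norml; lra.
have eqnN z : - v11 z + - v22 z = a1 z * - v1 z + a2 z * - v2 z.
  by rewrite -opprD eqn; ring.
have lo p q : s1 <= p <= s2 -> t1 <= q <= t2 -> - v (p, q) <= - k + 2 * del.
  apply: (max_principle (C1N Cv) (C1N Cv1) (C1N Cv2) ca1 s12 t12 eqnN) => p' q' h1 h2 h3.
  by have := bd p' q' h1 h2 h3; rewrite ler_norml; lra.
have xs : s1 <= x <= s2 by lra.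
have yt : t1 <= y <= t2 by lra.
have xs0 : s1 <= 0 <= s2 by lra.
have yt0 : t1 <= 0 <= t2 by lra.
have u1 := up x y xs yt; have u2 := up 0 0 xs0 yt0.
have l1 := lo x y xs yt; have l2 := lo 0 0 xs0 yt0.
by rewrite ler_norml; lra.
Qed.

End Flat.

(** * The Euclidean norm, and components of vector-valued operators *)

Section Eucl.
Variable R : realType.
Implicit Types x : R * R.

Lemma eucl_ge0 x : 0 <= eucl x. Proof. exact: sqrtr_ge0. Qed.

Lemma norm1_le_eucl x : `|x.1| <= eucl x.
Proof. by rewrite -sqrtr_sqr ler_wsqrtr// lerDl sqr_ge0. Qed.

Lemma norm2_le_eucl x : `|x.2| <= eucl x.
Proof. by rewrite -sqrtr_sqr ler_wsqrtr// lerDr sqr_ge0. Qed.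

Lemma eucl_le_sum x : eucl x <= `|x.1| + `|x.2|.
Proof.
have h : 0 <= `|x.1| + `|x.2| by rewrite addr_ge0.
rewrite /eucl -[leRHS]ger0_norm// -sqrtr_sqr ler_wsqrtr//.
rewrite sqrrD !normsq -addrA lerD2l lerDr mulrn_wge0// mulr_ge0//.
Qed.

Lemma cont_eucl (F : R * R -> R * R) : continuous F -> continuous (fun x => eucl (F x)).
Proof.
move=> cF.
have c : continuous (fun x => (F x).1 ^+ 2 + (F x).2 ^+ 2).
  by apply: contD; apply: contX; [exact: cont_comp_fst|exact: cont_comp_snd].
by move=> x; apply: (continuous_comp (c x)); exact: sqrt_continuous.
Qed.

End Eucl.

Section Smooth.
Variable R : realType.
Implicit Types f : R * R -> R.

Lemma schwarz f : smooth f -> d2 (d1 f) = d1 (d2 f).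
Proof.
move=> sf; apply/funext => x.
exact: (mixed_partials (smooth_C1 sf) (smooth_C1 (smooth_d1 sf))
  (smooth_C1 (smooth_d2 sf))).
Qed.

Lemma laplacian_fst (F : R * R -> R * R) x : smooth F ->
  (laplacian F x).1 = laplacian (fun y => (F y).1) x.
Proof.
move=> sF; have [_ [e1 e2]] := smooth_fst sF.
have [_ [e11 _]] := smooth_fst (smooth_d1 sF).
have [_ [_ e22]] := smooth_fst (smooth_d2 sF).
by rewrite /laplacian (funext e1) (funext e2) e11 e22.
Qed.

Lemma laplacian_snd (F : R * R -> R * R) x : smooth F ->
  (laplacian F x).2 = laplacian (fun y => (F y).2) x.
Proof.
move=> sF; have [_ [e1 e2]] := smooth_snd sF.
have [_ [e11 _]] := smooth_snd (smooth_d1 sF).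
have [_ [_ e22]] := smooth_snd (smooth_d2 sF).
by rewrite /laplacian (funext e1) (funext e2) e11 e22.
Qed.

Lemma advect_fst (v F : R * R -> R * R) x : smooth F ->
  (advect v F x).1 = advect v (fun y => (F y).1) x.
Proof. by move=> /smooth_fst[_ [e1 e2]]; rewrite /advect e1 e2. Qed.

Lemma advect_snd (v F : R * R -> R * R) x : smooth F ->
  (advect v F x).2 = advect v (fun y => (F y).2) x.
Proof. by move=> /smooth_snd[_ [e1 e2]]; rewrite /advect e1 e2. Qed.

Lemma advect_zero (V : normedModType R) (v : R * R -> R * R) (F : R * R -> V) x :
  (v x).1 = 0 -> (v x).2 = 0 -> advect v F x = 0.
Proof. by rewrite /advect => -> ->; rewrite !scale0r addr0. Qed.

End Smooth.

(** * The magnetic field and the velocity *)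

Section Induction.
Variable R : realType.

Lemma C1_d1E (f f1 f2 : R * R -> R) : C1 f f1 f2 -> d1 f = f1.
Proof. by move=> [_ _ _ df _]; apply/funext => x; have [_ <-] := df x. Qed.
Lemma C1_d2E (f f1 f2 : R * R -> R) : C1 f f1 f2 -> d2 f = f2.
Proof. by move=> [_ _ _ _ df]; apply/funext => x; have [_ <-] := df x. Qed.

Let induction_alg (u1 u2 b1 b2 d1b1 d1b2 d2b2 d1u1 d1u2 d2u2 d11b2 d22b2 d12b1 : R) :
  d22b2 = - d12b1 -> d2u2 = - d1u1 -> d2b2 = - d1b1 ->
  - (d11b2 + d22b2) + (u1 * d1b2 + u2 * d2b2) = b1 * d1u2 + b2 * d2u2 ->
  d12b1 + - d11b2 + (d1u1 * b2 + u1 * d1b2 + - (d1u2 * b1 + u2 * d1b1)) = 0.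
Proof. by move=> -> -> ->; lra. Qed.

Let induction_alg' (u1 u2 b1 b2 d1b1 d2b1 d2b2 d1u1 d2u1 d2u2 d11b1 d22b1 d21b2 : R) :
  d11b1 = - d21b2 -> d2u2 = - d1u1 -> d2b2 = - d1b1 ->
  - (d11b1 + d22b1) + (u1 * d1b1 + u2 * d2b1) = b1 * d1u1 + b2 * d2u1 ->
  d22b1 + - d21b2 + (d2u1 * b2 + u1 * d2b2 + - (d2u2 * b1 + u2 * d2b1)) = 0.
Proof. by move=> -> -> ->; lra. Qed.

Variables (alpha beta c0 : R) (U1 U2 B1 B2 : R * R -> R).
Hypotheses (sU1 : smooth U1) (sU2 : smooth U2) (sB1 : smooth B1) (sB2 : smooth B2).
Hypothesis divU : forall x, d1 U1 x + d2 U2 x = 0.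
Hypothesis divB : forall x, d1 B1 x + d2 B2 x = 0.
Hypothesis ind1 : forall x, - (d1 (d1 B1) x + d2 (d2 B1) x)
  + (U1 x * d1 B1 x + U2 x * d2 B1 x)
  = B1 x * d1 U1 x + B2 x * d2 U1 x.
Hypothesis ind2 : forall x, - (d1 (d1 B2) x + d2 (d2 B2) x)
  + (U1 x * d1 B2 x + U2 x * d2 B2 x)
  = B1 x * d1 U2 x + B2 x * d2 U2 x.

(** Ohm's law: the current plus the electromotive force of the flow. *)
Let ohm x := d2 B1 x - d1 B2 x + (U1 x * B2 x - U2 x * B1 x).

(** Both components of the induction equation are, up to sign, partial
derivatives of this quantity, because u and b are divergence free. *)
Lemma ohm_const x y : ohm x = ohm y.
Proof.
have C1h := C1D (smooth_C1 (smooth_d2 sB1)) (C1N (smooth_C1 (smooth_d1 sB2))).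
have C1e := C1D (C1M (smooth_C1 sU1) (smooth_C1 sB2))
  (C1N (C1M (smooth_C1 sU2) (smooth_C1 sB1))).
have [_ _ _ o1 o2] := C1D C1h C1e.
have dB : d2 B2 = (fun x => - d1 B1 x).
  by apply/funext => z; apply/eqP; rewrite -addr_eq0 addrC divB.
have dB' : d1 B1 = (fun x => - d2 B2 x).
  by apply/funext => z; apply/eqP; rewrite -addr_eq0 divB.
have dU z : d2 U2 z = - d1 U1 z.
  by apply/eqP; rewrite -addr_eq0 addrC divU.
have dBz z : d2 B2 z = - d1 B1 z by rewrite dB.
have e22 z : d2 (d2 B2) z = - d1 (d2 B1) z.
  by rewrite dB (C1_d2E (C1N (smooth_C1 (smooth_d1 sB1)))) schwarz.
have e11 z : d1 (d1 B1) z = - d2 (d1 B2) z.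
  by rewrite dB' (C1_d1E (C1N (smooth_C1 (smooth_d2 sB2)))) -schwarz.
apply: (grad0_const (f := ohm)) => z.
- have := o1 z; rewrite (induction_alg (e22 z) (dU z) (dBz z) (ind2 z)); exact.
- have := o2 z; rewrite (induction_alg' (e11 z) (dU z) (dBz z) (ind1 z)); exact.
Qed.

Hypotheses (c0_gt0 : 0 < c0) (alpha_gt0 : 0 < alpha) (beta_lt : beta < - alpha).
Hypothesis growU : forall x, `|U1 x| <= c0 * (1 + eucl x) `^ alpha /\
  `|U2 x| <= c0 * (1 + eucl x) `^ alpha.
Hypothesis growB : forall x, `|B1 x| <= c0 * (1 + eucl x) `^ beta /\
  `|B2 x| <= c0 * (1 + eucl x) `^ beta.

(** |u| |b| = O(|x|^(alpha + beta)), and alpha + beta < 0. *)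
Lemma emf_decay (k : R) : 0 < k -> exists L0, forall x y, L0 <= x ->
  `|U1 (x, y) * B2 (x, y) - U2 (x, y) * B1 (x, y)| <= k.
Proof.
move=> k0; pose gam := - (alpha + beta).
have gam0 : 0 < gam by rewrite /gam; move: beta_lt; lra.
have cc0 : 0 < 2 * c0 ^+ 2 by rewrite mulr_gt0// exprn_gt0.
pose T := 2 * c0 ^+ 2 / k.
have T0 : 0 < T by rewrite divr_gt0.
(* Where 1 + |x| reaches T^(1 / gam), the bound 2 c0^2 (1 + |x|)^(- gam) has
   dropped to k. *)
exists (T `^ gam^-1) => x y xL.
set z := (x, y).
have ez : T `^ gam^-1 <= 1 + eucl z.
  have := norm1_le_eucl z; have := ler_norm x; rewrite /z /=; lra.
have e0 : 0 < 1 + eucl z by have := eucl_ge0 z; lra.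
have Te : T <= (1 + eucl z) `^ gam.
  rewrite [leLHS](_ : T = (T `^ gam^-1) `^ gam); last first.
    by rewrite -powRrM mulVf ?powRr1 ?(ltW T0)// gt_eqF.
  by apply: ge0_ler_powR; rewrite ?nnegrE ?powR_ge0// ltW.
have [u1 u2] := growU z; have [b1 b2] := growB z.
have P : (1 + eucl z) `^ alpha * (1 + eucl z) `^ beta * (1 + eucl z) `^ gam = 1.
  rewrite -!powRD; try by apply/implyP => _; rewrite gt_eqF.
  by rewrite /gam subrr powRr0.
set p := (1 + eucl z) `^ alpha in P u1 u2 *.
set q := (1 + eucl z) `^ beta in P b1 b2 *.
set g := (1 + eucl z) `^ gam in P Te *.
have p0 : 0 <= p by exact: powR_ge0.
have q0 : 0 <= q by exact: powR_ge0.
have m1 : `|U1 z * B2 z| <= c0 * p * (c0 * q) by rewrite normrM ler_pM.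
have m2 : `|U2 z * B1 z| <= c0 * p * (c0 * q) by rewrite normrM ler_pM.
have : 2 * c0 ^+ 2 * (p * q) <= k.
  have kT : k * T = 2 * c0 ^+ 2 by rewrite /T; field; rewrite gt_eqF.
  rewrite -kT -mulrA -[leRHS]mulr1 ler_pM2l// -P mulrC.
  by apply: ler_wpM2l => //; rewrite mulr_ge0.
by have := ler_normB (U1 z * B2 z) (U2 z * B1 z); lra.
Qed.

Lemma magnetic_vanish (g : R * R -> R) : continuous g ->
  (forall x, `|B1 x| <= g x) -> (forall x, `|B2 x| <= g x) ->
  (\int[@lebesgue2 R]_z (g z)%:E < +oo)%E ->
  (forall x, B1 x = 0) /\ (forall x, B2 x = 0).
Proof.
move=> cg g1 g2 goo.
have CB1 := smooth_C1 sB1; have CB2 := smooth_C1 sB2.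
have [psi Cpsi] := stream_function CB1 CB2 divB.
pose c := ohm (0, 0).
have eqn z : - d1 B2 z + d2 B1 z = c + (U1 z * - B2 z + U2 z * B1 z).
  by have := ohm_const z (0, 0); rewrite -/c /ohm; lra.
have Bbd z : `|B1 z| <= c0 /\ `|B2 z| <= c0.
  have [b1 b2] := growB z.
  have : c0 * (1 + eucl z) `^ beta <= c0.
    rewrite -[leRHS]mulr1 ler_pM2l// -[leRHS](powRr0 (1 + eucl z)) ler_powR//.
      by have := eucl_ge0 z; lra.
    by move: beta_lt alpha_gt0; lra.
  by split; [apply: le_trans b1 _|apply: le_trans b2 _].
have c_eq0 : c = 0.
  apply/eqP/negPn/negP => cn0.
  have k0 : 0 < `|c| / 2 by rewrite divr_gt0// normr_gt0.
  have [L0 HL] := emf_decay k0.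
  (* For c < 0, the source is the Laplacian of - psi. *)
  have [cp|cm|ce] := ltgtP c 0; last by rewrite ce eqxx in cn0.
  - apply: (@no_source R _ _ _ _ _ _ _ c0 (`|c| / 2) L0
      (C1N Cpsi) (C1N (C1N CB2)) (C1N CB1) k0).
    + by move=> z; rewrite !normrN; have [] := Bbd z.
    + by move=> z; rewrite normrN; have [] := Bbd z.
    move=> x y xL; have := HL x y xL; have := eqn (x, y).
    by rewrite (ltr0_norm cp) ler_norml; lra.
  - apply: (@no_source R _ _ _ _ _ _ _ c0 (`|c| / 2) L0
      Cpsi (C1N CB2) CB1 k0).
    + by move=> z; rewrite !normrN; have [] := Bbd z.
    + by move=> z; have [] := Bbd z.
    move=> x y xL; have := HL x y xL; have := eqn (x, y).
    by rewrite (gtr0_norm cm) ler_norml; lra.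
have cU1 : continuous U1 by case: (smooth_C1 sU1).
have flat z : psi z = psi (0, 0).
  apply: (integrable_gradient_flat Cpsi (C1N CB2) CB1 cU1 cg _ _ _ goo).
  - by move=> x; rewrite eqn c_eq0 add0r.
  - by move=> x; rewrite normrN.
  - exact: g1.
have Cc : C1 psi (fun=> 0) (fun=> 0).
  by apply: (C1_eq (C1_cst (psi (0, 0)))) => // z; rewrite flat.
split=> x; first by rewrite (C1_uniq2 Cpsi Cc).
by apply: oppr_inj; rewrite oppr0 (C1_uniq1 Cpsi Cc x).
Qed.

End Induction.

Section NavierStokes.
Variable R : realType.
Variables (alpha C : R).
Hypotheses (alpha_ge0 : 0 <= alpha) (alpha_lt : alpha < 3%:R^-1) (C_ge1 : 1 <= C).

Definition grows (f : R * R -> R) := forall r x y, 1 <= r -> `|x| <= r -> `|y| <= r ->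
  `|f (x, y)| <= C * r `^ alpha.

Lemma grows0 : grows (fun=> 0).
Proof.
move=> r x y r1 _ _; rewrite normr0 mulr_ge0 ?powR_ge0//; move: C_ge1; lra.
Qed.

(** The partial derivatives of f are harmonic, and they are the curls of
(0, - f) and (f, 0). *)
Lemma harmonic_const (f : R * R -> R) : smooth f -> grows f ->
  (forall x, d1 (d1 f) x + d2 (d2 f) x = 0) ->
  (forall x, d1 f x = 0) /\ (forall x, d2 f x = 0).
Proof.
move=> sf gf harm.
have s1 := smooth_d1 sf; have s2 := smooth_d2 sf.
have Cf := smooth_C1 sf.
have gNf : grows (fun x => - f x) by move=> r x y *; rewrite normrN; exact: gf.
have g0 := grows0.
have Ch := C1D (smooth_C1 (smooth_d1 s1)) (smooth_C1 (smooth_d2 s2)).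
have Ch0 : C1 (fun x => d1 (d1 f) x + d2 (d2 f) x) (fun=> 0) (fun=> 0).
  by apply: (C1_eq (C1_cst 0)) => // x; rewrite harm.
have D1 z : d1 (d1 (d1 f)) z + d2 (d2 (d1 f)) z = 0.
  have e : d2 (d2 (d1 f)) = d1 (d2 (d2 f)).
    by rewrite (schwarz sf) (schwarz s2).
  by rewrite e; exact: (C1_uniq1 Ch Ch0 z).
have D2 z : d1 (d1 (d2 f)) z + d2 (d2 (d2 f)) z = 0.
  have e : d1 (d1 (d2 f)) = d2 (d1 (d1 f)).
    by rewrite -(schwarz sf) -(schwarz s1).
  by rewrite e; exact: (C1_uniq2 Ch Ch0 z).
have Z := C1_cst (0 : R).
split.
- apply: (@transport_liouville R alpha C alpha_ge0 alpha_lt C_ge1 _ _ _ _ _ _ _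
    _ _ _ _ _ _ _ _ _ _ _ _ (smooth_C1 s1) (smooth_C1 (smooth_d1 s1))
    (smooth_C1 (smooth_d2 s1)) Z Z Z (C1N Cf)) => [z|z|z|r x y r1 xr yr].
  + by rewrite D1; ring.
  + by rewrite addr0.
  + by rewrite sub0r opprK.
  + by have z0 := g0 r x y r1 xr yr; split => //; exact: gNf.
- apply: (@transport_liouville R alpha C alpha_ge0 alpha_lt C_ge1 _ _ _ _ _ _ _
    _ _ _ _ _ _ _ _ _ _ _ _ (smooth_C1 s2) (smooth_C1 (smooth_d1 s2))
    (smooth_C1 (smooth_d2 s2)) Z Z Cf Z) => [z|z|z|r x y r1 xr yr].
  + by rewrite D2; ring.
  + by rewrite addr0.
  + by rewrite subr0.
  + by have z0 := g0 r x y r1 xr yr; split => //; exact: gf.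
Qed.

Let vorticity_alg (u1 u2 d1u1 d2u1 d1u2 d2u2 x211 x112 x222 x21 x12 x22
    y111 y122 y221 y11 y12 y21 p21 p12 : R) :
  x211 = x112 -> y122 = y221 -> x21 = x12 -> y12 = y21 -> p21 = p12 -> d2u2 = - d1u1 ->
  - (x211 + x222) + (d2u1 * d1u1 + u1 * x21 + (d2u2 * d2u1 + u2 * x22)) + p21 = 0 ->
  - (y111 + y122) + (d1u1 * d1u2 + u1 * y11 + (d1u2 * d2u2 + u2 * y12)) + p12 = 0 ->
  x112 + - y111 + (x222 + - y221) = u1 * (x12 + - y11) + u2 * (x22 + - y21).
Proof. by move=> -> -> -> -> -> ->; lra. Qed.

(** The pressure disappears from the curl of the momentum equation, by symmetry
of its second derivatives, and the stretching term is w div u = 0. *)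
Lemma navier_stokes_liouville (U1 U2 p : R * R -> R) :
  smooth U1 -> smooth U2 -> smooth p -> grows U1 -> grows U2 ->
  (forall x, d1 U1 x + d2 U2 x = 0) ->
  (forall x, - (d1 (d1 U1) x + d2 (d2 U1) x) + (U1 x * d1 U1 x + U2 x * d2 U1 x) + d1 p x
    = 0) ->
  (forall x, - (d1 (d1 U2) x + d2 (d2 U2) x) + (U1 x * d1 U2 x + U2 x * d2 U2 x) + d2 p x
    = 0) ->
  [/\ forall x, U1 x = U1 (0, 0), forall x, U2 x = U2 (0, 0) & forall x, p x = p (0, 0)].
Proof.
move=> s1 s2 sp gr1 gr2 divU mom1 mom2.
have s11 := smooth_d1 s1; have s12 := smooth_d2 s1.
have s21 := smooth_d1 s2; have s22 := smooth_d2 s2.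
have CU1 := smooth_C1 s1; have CU2 := smooth_C1 s2.
have dU z : d2 U2 z = - d1 U1 z by apply/eqP; rewrite -addr_eq0 addrC divU.
pose w x := d2 U1 x + - d1 U2 x.
have Cw := C1D (smooth_C1 s12) (C1N (smooth_C1 s21)).
have Cw1 := C1D (smooth_C1 (smooth_d1 s12)) (C1N (smooth_C1 (smooth_d1 s21))).
have Cw2 := C1D (smooth_C1 (smooth_d2 s12)) (C1N (smooth_C1 (smooth_d2 s21))).
have Cm1 := C1D (C1D (C1N (C1D (smooth_C1 (smooth_d1 s11)) (smooth_C1 (smooth_d2 s12))))
   (C1D (C1M CU1 (smooth_C1 s11)) (C1M CU2 (smooth_C1 s12)))) (smooth_C1 (smooth_d1 sp)).
have Cm2 := C1D (C1D (C1N (C1D (smooth_C1 (smooth_d1 s21)) (smooth_C1 (smooth_d2 s22))))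
   (C1D (C1M CU1 (smooth_C1 s21)) (C1M CU2 (smooth_C1 s22)))) (smooth_C1 (smooth_d2 sp)).
have m1 z := C1_uniq2 Cm1 (C1_eq (C1_cst 0) (fun x => esym (mom1 x)) (fun=> erefl)
  (fun=> erefl)) z.
have m2 z := C1_uniq1 Cm2 (C1_eq (C1_cst 0) (fun x => esym (mom2 x)) (fun=> erefl)
  (fun=> erefl)) z.
have eA z : d2 (d1 (d1 U1)) z = d1 (d1 (d2 U1)) z.
  by rewrite (schwarz s11) (schwarz s1).
have eB z : d1 (d2 (d2 U2)) z = d2 (d2 (d1 U2)) z.
  by rewrite (schwarz s2) (schwarz s22).
have eC z : d2 (d1 U1) z = d1 (d2 U1) z by rewrite (schwarz s1).
have eD z : d1 (d2 U2) z = d2 (d1 U2) z by rewrite (schwarz s2).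
have eE z : d2 (d1 p) z = d1 (d2 p) z by rewrite (schwarz sp).
have w0 : forall z, w z = 0.
  apply: (@transport_liouville R alpha C alpha_ge0 alpha_lt C_ge1 _ _ _ _ _ _ _
    _ _ _ _ _ _ _ _ _ _ _ _ Cw Cw1 Cw2 CU1 CU2 CU1 CU2) => [z|z|z|r x y r1 xr yr].
  - exact: (vorticity_alg (eA z) (eB z) (eC z) (eD z) (eE z) (dU z) (m1 z) (m2 z)).
  - exact: divU.
  - by [].
  - by split; [exact: gr1|exact: gr2|exact: gr1|exact: gr2].
have curl0 : d2 U1 = d1 U2.
  by apply/funext => z; apply/eqP; rewrite -subr_eq0; apply/eqP; exact: w0.
have div1 : d2 U2 = (fun x => - d1 U1 x) by apply/funext => z; exact: dU.
have div2 : d1 U1 = (fun x => - d2 U2 x).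
  by apply/funext => z; apply/eqP; rewrite -addr_eq0 divU.
have lap1 z : d1 (d1 U1) z + d2 (d2 U1) z = 0.
  have -> : d2 (d2 U1) z = - d1 (d1 U1) z; last by rewrite subrr.
  by rewrite curl0 (schwarz s2) div1 (C1_d1E (C1N (smooth_C1 s11))).
have lap2 z : d1 (d1 U2) z + d2 (d2 U2) z = 0.
  have -> : d1 (d1 U2) z = - d2 (d2 U2) z; last by rewrite addNr.
  by rewrite -curl0 -(schwarz s1) div2 (C1_d2E (C1N (smooth_C1 s22))).
have [d11 d12] := harmonic_const s1 gr1 lap1.
have [d21 d22] := harmonic_const s2 gr2 lap2.
have cst (f : R * R -> R) : smooth f -> (forall x, d1 f x = 0) -> (forall x, d2 f x = 0) ->
    forall x, f x = f (0, 0).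
  move=> sf z1 z2 x; have [_ _ _ f1 f2] := smooth_C1 sf.
  by apply: grad0_const => z; [rewrite -(z1 z)|rewrite -(z2 z)].
split; [exact: (cst U1)|exact: (cst U2)|apply: (cst p) => // x].
- by have := mom1 x; rewrite lap1 d11 d12 !mulr0 oppr0 !add0r.
- by have := mom2 x; rewrite lap2 d21 d22 !mulr0 oppr0 !add0r.
Qed.

End NavierStokes.

(** * The theorem *)

(** On the square, 1 + |x| <= 1 + 2 r <= 3 r, and 3^alpha <= 3. *)
Lemma grows_eucl (R : realType) (alpha c0 : R) (f : R * R -> R) : 0 <= alpha -> alpha
  <= 1 ->
  0 <= c0 -> (forall x, `|f x| <= c0 * (1 + eucl x) `^ alpha) ->
  grows alpha (1 + 3 * c0) f.
Proof.
move=> a0 a1 c00 fb r x y r1 xr yr.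
apply: le_trans (fb (x, y)) _.
have e3 : 1 + eucl (x, y) <= 3 * r by have := eucl_le_sum (x, y); rewrite /=; lra.
have e0 := eucl_ge0 (x, y).
have h1 : (1 + eucl (x, y)) `^ alpha <= (3 * r) `^ alpha.
  by apply: ge0_ler_powR => //; rewrite nnegrE; lra.
have h2 : (3 * r) `^ alpha <= 3 * r `^ alpha.
  rewrite powRM; [|lra|lra]; rewrite ler_wpM2r ?powR_ge0//.
  by rewrite -[leRHS]powRr1 ?ler_powR; lra.
have r0 : 0 <= r `^ alpha by exact: powR_ge0.
have h3 : c0 * (1 + eucl (x, y)) `^ alpha <= c0 * (3 * r `^ alpha).
  by rewrite ler_wpM2l// (le_trans h1).
lra.
Qed.

Lemma proj_eqn1 (R : realType) (l a c : R * R) (l' a' c' : R) :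
  - l + a = c -> l.1 = l' -> a.1 = a' -> c.1 = c' -> - l' + a' = c'.
Proof. by move=> <- <- <- <-. Qed.

Lemma proj_eqn2 (R : realType) (l a c : R * R) (l' a' c' : R) :
  - l + a = c -> l.2 = l' -> a.2 = a' -> c.2 = c' -> - l' + a' = c'.
Proof. by move=> <- <- <- <-. Qed.

Theorem theorem1p1 (R : realType) (alpha beta c0 : R)
    (alpha_gt0 : 0 < alpha) (alpha_lt : alpha < 3%:R^-1)
    (beta_lt : beta < - alpha) (c0_gt0 : 0 < c0) :
  exists2 eps0 : R, 0 < eps0 &
    forall (u b : R * R -> R * R) (p : R * R -> R),
      smooth_stationary_MHD u b p ->
      (forall x, eucl (u x) <= c0 * (1 + eucl x) `^ alpha) ->
      (forall x, eucl (b x) <= c0 * (1 + eucl x) `^ beta) ->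
      (L1norm (fun x => eucl (b x))
       + L1norm (fun x => (`|current b x| `^ (3%:R^-1))%R) <= eps0%:E)%E ->
      [/\ exists c : R * R, forall x, u x = c,
          exists q : R, forall x, p x = q &
          forall x, b x = 0].
Proof.
(* The bound is used through the finiteness of the L1 norm of b. *)
exists 1 => // u b p [su sb sp mom ind divu divb] growu growb small.
pose U1 x := (u x).1; pose U2 x := (u x).2.
pose B1 x := (b x).1; pose B2 x := (b x).2.
have [sU1 [u11 u12]] := smooth_fst su; have [sU2 [u21 u22]] := smooth_snd su.
have [sB1 [b11 b12]] := smooth_fst sb; have [sB2 [b21 b22]] := smooth_snd sb.
have divU x : d1 U1 x + d2 U2 x = 0 := divu x.
have divB x : d1 B1 x + d2 B2 x = 0 := divb x.
have ind1 x : - (d1 (d1 B1) x + d2 (d2 B1) x) + (U1 x * d1 B1 x + U2 x * d2 B1 x)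
    = B1 x * d1 U1 x + B2 x * d2 U1 x.
  exact: (proj_eqn1 (ind x) (laplacian_fst x sb) (advect_fst u x sb) (advect_fst b x su)).
have ind2 x : - (d1 (d1 B2) x + d2 (d2 B2) x) + (U1 x * d1 B2 x + U2 x * d2 B2 x)
    = B1 x * d1 U2 x + B2 x * d2 U2 x.
  exact: (proj_eqn2 (ind x) (laplacian_snd x sb) (advect_snd u x sb) (advect_snd b x su)).
have growU x : `|U1 x| <= c0 * (1 + eucl x) `^ alpha /\ `|U2 x|
  <= c0 * (1 + eucl x) `^ alpha.
  by split; apply: le_trans (growu x); [exact: norm1_le_eucl|exact: norm2_le_eucl].
have growB x : `|B1 x| <= c0 * (1 + eucl x) `^ beta /\ `|B2 x| <= c0 * (1 + eucl x) `^ beta.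
  by split; apply: le_trans (growb x); [exact: norm1_le_eucl|exact: norm2_le_eucl].
have cb : continuous b by have [] := sb 0%N.
have finb : (\int[@lebesgue2 R]_z (eucl (b z))%:E < +oo)%E.
  have le1 : (L1norm (fun x => eucl (b x)) <= 1%:E)%E.
    by apply: le_trans small; rewrite leeDl// Lnorm_ge0.
  apply: (@le_lt_trans _ _ 1%:E); last exact: ltry.
  move: le1; rewrite /L1norm Lnorm1.
  rewrite (_ : (\int[@lebesgue2 R]_z _)%E = (\int[@lebesgue2 R]_z (eucl (b z))%:E)%E)//.
  by apply: eq_integral => z _ /=; rewrite ger0_norm// eucl_ge0.
have [B1z B2z] := magnetic_vanish sU1 sU2 sB1 sB2 divU divB ind1 ind2 c0_gt0
  alpha_gt0 beta_lt growU growB (cont_eucl cb) (fun x => norm1_le_eucl (b x))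
  (fun x => norm2_le_eucl (b x)) finb.
have b0 x : b x = 0.
  by rewrite [LHS]surjective_pairing; congr (_, _); [exact: B1z|exact: B2z].
have adv0 x : advect b b x = 0 := advect_zero b (B1z x) (B2z x).
have mom1 x : - (d1 (d1 U1) x + d2 (d2 U1) x) + (U1 x * d1 U1 x + U2 x * d2 U1 x) + d1 p x
  = 0.
  have h : - (laplacian u x).1 + (advect u u x).1 + d1 p x = (advect b b x).1 :=
    congr1 fst (mom x).
  by rewrite adv0 (laplacian_fst x su) (advect_fst u x su) in h.
have mom2 x : - (d1 (d1 U2) x + d2 (d2 U2) x) + (U1 x * d1 U2 x + U2 x * d2 U2 x) + d2 p x
  = 0.
  have h : - (laplacian u x).2 + (advect u u x).2 + d2 p x = (advect b b x).2 :=
    congr1 snd (mom x).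
  by rewrite adv0 (laplacian_snd x su) (advect_snd u x su) in h.
have three : 3 * 3%:R^-1 = 1 :> R by rewrite divff.
have alpha1 : alpha <= 1.
  by apply: ltW; apply: (lt_trans alpha_lt); lra.
have C1le : 1 <= 1 + 3 * c0 by rewrite lerDl mulr_ge0// ltW.
have [cU1 cU2 cp] := navier_stokes_liouville (ltW alpha_gt0) alpha_lt C1le sU1 sU2 sp
  (grows_eucl (ltW alpha_gt0) alpha1 (ltW c0_gt0) (fun x => (growU x).1))
  (grows_eucl (ltW alpha_gt0) alpha1 (ltW c0_gt0) (fun x => (growU x).2))
  divU mom1 mom2.
split=> //.
- exists (u (0, 0)) => x.
  by rewrite [LHS]surjective_pairing [RHS]surjective_pairing; congr (_, _);
    [exact: cU1|exact: cU2].
- by exists (p (0, 0)).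
Qed.
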